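(* Let $\alpha=M\nu^{-2}\|f\|_{-1}$, $\alpha_\delta=(1+\delta)\alpha$ and $C_\delta=2\sqrt{1+(1+\delta)^2}$. Let $u\in V$ be a steady Navier-Stokes solution, $\epsilon\in V$ the noise function with $\|\nabla(u+\epsilon)\|\le(1+\delta)\|\nabla u\|$, $u_0\in V$, and let $(u_k)_{k\ge0}\subset V$ be the CDA-Picard iterates with noisy data, defined by $$\nu(\nabla u_{k+1},\nabla v)+b(u_k,u_{k+1},v)+\mu\big(I_Hu_{k+1}-I_H(u+\epsilon),\,I_Hv\big)=(f,v)\qquad\forall v\in V .$$ Suppose $\alpha_\delta<\frac13$. Then for any $H>0$ and $\mu\ge0$, and for all sufficiently large $k$, $$\|\nabla(u_{k+1}-u_k)\|\le C_\delta\,\alpha\,\|\nabla(u_k-u_{k-1})\| .$$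
   Context: $\Omega\subset\mathbb{R}^d$, $d\in\{2,3\}$, is an open connected set that is a convex polygon or has smooth boundary. $(\cdot,\cdot)$ and $\|\cdot\|$ denote the $L^2(\Omega)$ inner product and norm. $X=\{v\in H^1(\Omega)^d: v=0\text{ on }\partial\Omega\}$, $Q=\{q\in L^2(\Omega):\int_\Omega q\,dx=0\}$, $V=\{v\in X:(\nabla\cdot v,q)=0\ \forall q\in Q\}$ (the divergence-free subspace). $\nu>0$ is the viscosity, $f\in H^{-1}(\Omega)^d$ is the forcing, $(f,v)=\langle f,v\rangle$ is the duality pairing, and $\|\cdot\|_{-1}$ is the $H^{-1}$ norm (dual to $\|\nabla\cdot\|$). $b(u,w,v)=((u\cdot\nabla)w,v)$. $M$ is a constant depending only on $\Omega$ such that $b(u,w,v)\le M\|u\|^{1/2}\|\nabla u\|^{1/2}\|\nabla w\|\|\nabla v\|$ and $b(u,w,v)\le M\|\nabla u\|\|\nabla w\|\|\nabla v\|$ for $u,w,v\in X$. A steady Navier-Stokes solution is a $u\in V$ with $\nu(\nabla u,\nabla v)+b(u,u,v)=\langle f,v\rangle$ for all $v\in V$; the paper assumes throughout that $\|\nabla u\|_{L^\infty}<\infty$. Data assimilation: $H>0$ is the width of a coarse mesh of $\Omega$, and $I_H$ is a (linear) coarse mesh interpolation operator for which there is a constant $C_I>0$ independent of $H$ with $\|I_Hv-v\|\le C_IH\|\nabla v\|$ and $\|I_Hv\|\le C_I\|v\|$ for all $v\in X$. $\mu$ is the nudging parameter. The known data are $u(x_i)+\epsilon_i$ at measurement points $x_i$;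 $\epsilon\in V$ is any divergence-free function with $I_H\epsilon(x_i)=\epsilon_i$, and $\delta\ge0$ is the relative noise size constant in $\|\nabla(u+\epsilon)\|\le(1+\delta)\|\nabla u\|$. *)

(* Defs.v *)
From HB Require Import structures.
From mathcomp Require Import all_boot all_order all_algebra.
From mathcomp Require Import all_classical all_reals all_analysis.
Set Implicit Arguments.
Unset Strict Implicit.
Unset Printing Implicit Defensive.
Import Order.TTheory GRing.Theory Num.Theory.
Import numFieldNormedType.Exports.
Local Open Scope classical_set_scope.
Local Open Scope ring_scope.

(* Points of R^d are row vectors. The sigma-algebra generated by the
   coordinates is the Borel sigma-algebra. *)
Section measurable_rV.
Context (R : realType) (d : nat).

Let coord (j : 'I_d) (x : 'rV[R]_d) : R := x ord0 j.

Let rV_set0 : g_sigma_preimage coord set0.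
Proof. exact: sigma_algebra0. Qed.

Let rV_setC A : g_sigma_preimage coord A -> g_sigma_preimage coord (~` A).
Proof. exact: sigma_algebraC. Qed.

Let rV_bigcup (F : (set 'rV[R]_d)^nat) :
  (forall i, g_sigma_preimage coord (F i)) ->
  g_sigma_preimage coord (\bigcup_i (F i)).
Proof. exact: sigma_algebra_bigcup. Qed.

HB.instance Definition _ := @isMeasurable.Build default_measure_display
  'rV[R]_d (g_sigma_preimage coord) rV_set0 rV_setC rV_bigcup.

Lemma measurable_coord (j : 'I_d) :
  measurable_fun [set: 'rV[R]_d] (fun x : 'rV[R]_d => x ord0 j).
Proof.
move=> _ Y mY; rewrite setTI; apply: sub_sigma_algebra => /=.
rewrite -bigcup_seq/=; exists j => /=; first by rewrite mem_index_enum.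
by exists Y => //; rewrite setTI.
Qed.

Lemma measurable_fun_rV dT (T : measurableType dT) (f : T -> 'rV[R]_d) :
  (forall j, measurable_fun setT (fun t => f t ord0 j)) ->
  measurable_fun setT f.
Proof.
move=> mf.
pose S := image_set_system setT f (@measurable _ T).
suff mS : g_sigma_preimage coord `<=` S by move=> _ Y mY; exact: mS.
apply: smallest_sub.
  exact/sigma_algebra_image/sigma_algebra_measurable.
rewrite -bigcup_seq/=; apply: bigcup_sub => j _ _ [B mB <-].
by rewrite /S /image_set_system /= !setTI -[X in measurable X]setTI; exact: mf.
Qed.

End measurable_rV.

Section lebesgue_rV.
Context (R : realType).

Definition rV_cons d (p : measurableTypeR R * 'rV[R]_d) : 'rV[R]_d.+1 :=
  row_mx (p.1)%:M p.2.

Let rV_uncons d (x : 'rV[R]_d.+1) : measurableTypeR R * 'rV[R]_d :=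
  (x ord0 ord0, \row_j x ord0 (lift ord0 j)).

Lemma measurable_rV_cons d : measurable_fun setT (@rV_cons d).
Proof.
apply: measurable_fun_rV => j.
have [i ->|i ->] := @split_ordP 1 d j.
- rewrite (_ : (fun _ => _) = fst) ?ord1; first exact: measurable_fst.
  apply/funext => p; rewrite /rV_cons; apply: (etrans (row_mxEl _ _ _ _)).
  by rewrite mxE eqxx mulr1n.
- rewrite (_ : (fun _ => _) = (fun x : 'rV[R]_d => x ord0 i) \o snd).
    apply: measurableT_comp; [exact: measurable_coord|exact: measurable_snd].
  by apply/funext => p; exact: row_mxEr.
Qed.

Let measurable_rV_uncons d : measurable_fun setT (@rV_uncons d).
Proof.
apply: measurable_fun_pair; first exact: measurable_coord.
apply: measurable_fun_rV => j.
rewrite (_ : (fun _ => _) = fun x : 'rV[R]_d.+1 => x ord0 (lift ord0 j)).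
  exact: measurable_coord.
by apply/funext => x; rewrite mxE.
Qed.

Let rV_consK d : cancel (@rV_cons d) (@rV_uncons d).
Proof.
move=> [a x]; rewrite /rV_uncons /rV_cons /=; congr pair.
  rewrite (_ : ord0 = lshift d (ord0 : 'I_1)); last exact/val_inj.
  by apply: (etrans (row_mxEl _ _ _ _)); rewrite mxE eqxx mulr1n.
apply/rowP => j; rewrite mxE (_ : lift ord0 j = rshift 1 j).
  exact: row_mxEr.
exact/val_inj.
Qed.

Section step.
Context (d : nat) (mu : {sigma_finite_measure set 'rV[R]_d -> \bar R}).

Definition lebesgue_cons : set 'rV[R]_d.+1 -> \bar R :=
  pushforward (@lebesgue_measure R \x mu)%E (@rV_cons d).

Let lebesgue_cons0 : lebesgue_cons set0 = 0%E.
Proof. by rewrite /lebesgue_cons /pushforward preimage_set0 measure0. Qed.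

Let lebesgue_cons_ge0 A : (0 <= lebesgue_cons A)%E.
Proof. by rewrite /lebesgue_cons /pushforward; exact: measure_ge0. Qed.

Let lebesgue_cons_sigma_additive : semi_sigma_additive lebesgue_cons.
Proof.
move=> F mF tF mUF; rewrite /lebesgue_cons /pushforward preimage_bigcup.
have mc := @measurable_rV_cons d.
apply: measure_semi_sigma_additive.
- by move=> n; rewrite -[X in measurable X]setTI; exact: mc.
- apply/trivIsetP => /= i j _ _ ij; rewrite -preimage_setI.
  by move/trivIsetP : tF => /(_ _ _ _ _ ij) ->//; rewrite preimage_set0.
- by rewrite -preimage_bigcup -[X in measurable X]setTI; exact: mc.
Qed.

HB.instance Definition _ := isMeasure.Build _ _ _ lebesgue_cons
  lebesgue_cons0 lebesgue_cons_ge0 lebesgue_cons_sigma_additive.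

Let lebesgue_cons_sigma_finite : sigma_finite setT lebesgue_cons.
Proof.
have /sigma_finiteP[F [TF ndF Foo]] := sigma_finiteT (@lebesgue_measure R).
have /sigma_finiteP[G [TG ndG Goo]] := sigma_finiteT mu.
exists (fun n => @rV_uncons d @^-1` (F n `*` G n)).
  apply/esym; rewrite -subTset => x _.
  have : setT (rV_uncons x).1 by [].
  rewrite TF => -[n _ Fn].
  have : setT (rV_uncons x).2 by [].
  rewrite TG => -[k _ Gk].
  exists (maxn n k) => //; split.
  - by move: Fn; exact/subsetPset/ndF/leq_maxl.
  - by move: Gk; exact/subsetPset/ndG/leq_maxr.
move=> n; have [mF Fn] := Foo n; have [mG Gn] := Goo n; split.
  rewrite -[X in measurable X]setTI; apply: measurable_rV_uncons => //.
  exact: measurableX.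
rewrite /lebesgue_cons /pushforward -comp_preimage.
rewrite (_ : _ \o _ = id); last by apply/funext => p /=; rewrite rV_consK.
by rewrite preimage_id product_measure1E// lte_mul_pinfty// ge0_fin_numE.
Qed.

HB.instance Definition _ := @Measure_isSigmaFinite.Build _ _ _ lebesgue_cons
  lebesgue_cons_sigma_finite.

End step.

(* d-dimensional Lebesgue measure: the d-fold product of lebesgue_measure. *)
Fixpoint lebesgue_rV (d : nat) : {sigma_finite_measure set 'rV[R]_d -> \bar R} :=
  if d is d'.+1 then lebesgue_cons (lebesgue_rV d')
  else \d_(0 : 'rV[R]_0).

End lebesgue_rV.

Section domains.
Context (R : realType) (d : nat).
Implicit Types (Omega : set 'rV[R]_d) (g : 'rV[R]_d -> R).

Definition pderive (j : 'I_d) g : 'rV[R]_d -> R :=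
  fun x => 'D_(delta_mx ord0 j) g x.

(* C^oo: all iterated partial derivatives exist and are continuous. *)
Definition smooth g := forall s : seq 'I_d,
  continuous (foldr pderive g s) /\
  forall (j : 'I_d) x, derivable (foldr pderive g s) x (delta_mx ord0 j).

(* Convex polygon (polyhedron if d = 3): bounded finite intersection of open
   half-spaces. *)
Definition convex_polygon Omega := bounded_set Omega /\
  exists (m : nat) (A : 'M[R]_(m, d)) (c : 'cV[R]_m),
    Omega = [set x | forall i, (A *m x^T) i ord0 < c i ord0].

(* Near each boundary point Omega is the sublevel set {g < 0} of a smooth
   defining function with nonvanishing gradient. *)
Definition smooth_boundary Omega :=
  forall x0, closure Omega x0 -> ~ Omega x0 ->
  exists U g, [/\ nbhs x0 U, smooth g, exists j, pderive j g x0 != 0 &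
    forall x, U x -> (Omega x <-> g x < 0)].

Definition admissible_domain Omega :=
  [/\ open Omega, connected Omega & convex_polygon Omega \/ smooth_boundary Omega].

Definition test_fun Omega g := smooth g /\
  exists K, [/\ compact K, K `<=` Omega & forall x, ~ K x -> g x = 0].

End domains.

Section L2.
Context (R : realType) (d : nat) (Omega : set 'rV[R]_d).
Let mu := lebesgue_rV R d.

Definition square_integrable (g : 'rV[R]_d -> R) :=
  measurable_fun Omega g /\ mu.-integrable Omega (fun x => (g x ^+ 2)%:E).

Definition mxdot m n (A B : 'M[R]_(m, n)) : R := \sum_i \sum_j A i j * B i j.

Definition L2 m n (F : 'rV[R]_d -> 'M[R]_(m, n)) :=
  forall i j, square_integrable (fun x => F x i j).

Definition L2dot m n (F G : 'rV[R]_d -> 'M[R]_(m, n)) : R :=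
  \int[mu]_(x in Omega) mxdot (F x) (G x).

Definition L2norm m n (F : 'rV[R]_d -> 'M[R]_(m, n)) : R :=
  Num.sqrt (L2dot F F).

End L2.

Notation vfield R d := ('rV[R]_d -> 'rV[R]_d) (only parsing).

(* An H^1 vector field v is carried together with its weak gradient, as the pair
   (v, grad v); the second component is determined a.e. by the first. *)
Notation h1field R d :=
  (('rV[R]_d -> 'rV[R]_d) * ('rV[R]_d -> 'M[R]_d))%type (only parsing).

Section spaces.
Context (R : realType) (d : nat) (Omega : set 'rV[R]_d).
Let mu := lebesgue_rV R d.

(* G x i j is the derivative of the i-th component in direction j. *)
Definition weak_gradient (v : vfield R d) (G : 'rV[R]_d -> 'M[R]_d) :=
  forall (i j : 'I_d) (phi : 'rV[R]_d -> R), test_fun Omega phi ->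
    \int[mu]_(x in Omega) (v x ord0 i * pderive j phi x) =
    - \int[mu]_(x in Omega) (G x i j * phi x).

Definition H1 : set (h1field R d) :=
  [set v | [/\ L2 Omega v.1, L2 Omega v.2 & weak_gradient v.1 v.2]].

Definition gradient (v : vfield R d) : 'rV[R]_d -> 'M[R]_d :=
  fun x => \matrix_(i, j) pderive j (fun y => v y ord0 i) x.

(* Vanishing on the boundary: limit in H^1 of test fields. *)
Definition zero_on_boundary (v : h1field R d) :=
  exists phi : nat -> vfield R d,
  [/\ forall n i, test_fun Omega (fun x => phi n x ord0 i),
      L2norm Omega (v.1 - phi n) @[n --> \oo] --> (0 : R) &
      L2norm Omega (v.2 - gradient (phi n)) @[n --> \oo] --> (0 : R)].

Definition X : set (h1field R d) := [set v | H1 v /\ zero_on_boundary v].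

Definition Q : set ('rV[R]_d -> R) :=
  [set q | [/\ square_integrable Omega q, mu.-integrable Omega (EFin \o q) &
    \int[mu]_(x in Omega) q x = 0]].

Definition divergence (v : h1field R d) : 'rV[R]_d -> R := fun x => \tr (v.2 x).

Definition V : set (h1field R d) :=
  [set v | X v /\ forall q, Q q ->
    \int[mu]_(x in Omega) (divergence v x * q x) = 0].

(* Members of H^{-1} act on the underlying functions; boundedness makes the
   action independent of the representative modulo a.e. equality. *)
Definition Hminus1 (f : vfield R d -> R) :=
  (forall (a : R) v w, X v -> X w ->
    f (a *: v.1 + w.1) = a * f v.1 + f w.1) /\
  exists C : R, forall v, X v -> `|f v.1| <= C * L2norm Omega v.2.

Definition Hminus1_norm (f : vfield R d -> R) : R :=
  sup [set r | exists v, [/\ X v, 0 < L2norm Omega v.2 &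
    r = `|f v.1| / L2norm Omega v.2]].

(* (u . grad) w *)
Definition convection (u w : h1field R d) : vfield R d :=
  fun x => u.1 x *m (w.2 x)^T.

Definition b (u w v : h1field R d) : R := L2dot Omega (convection u w) v.1.

(* The integral defining b converges absolutely (as it does on H^1_0 for
   d = 2, 3 by Sobolev embedding) and satisfies both bounds. *)
Definition b_bound (M : R) := forall u w v, X u -> X w -> X v ->
  [/\ mu.-integrable Omega (fun x => (mxdot (convection u w x) (v.1 x))%:E),
      b u w v <= M * Num.sqrt (L2norm Omega u.1) * Num.sqrt (L2norm Omega u.2)
                   * L2norm Omega w.2 * L2norm Omega v.2 &
      b u w v <= M * L2norm Omega u.2 * L2norm Omega w.2 * L2norm Omega v.2].

Definition steady_NSE (nu : R) (f : vfield R d -> R) (u : h1field R d) :=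
  V u /\ forall v, V v -> nu * L2dot Omega u.2 v.2 + b u u v = f v.1.

Definition bounded_gradient (u : h1field R d) :=
  exists C : R, {ae mu, forall x, Omega x -> `|u.2 x| <= C}.

Definition interpolation (CI H : R) (IH : vfield R d -> vfield R d) :=
  (forall (a : R) v w, X v -> X w -> {ae mu, forall x, Omega x ->
    IH (a *: v.1 + w.1) x = a *: IH v.1 x + IH w.1 x}) /\
  forall v, X v ->
    [/\ L2 Omega (IH v.1),
        L2norm Omega (IH v.1 - v.1) <= CI * H * L2norm Omega v.2 &
        L2norm Omega (IH v.1) <= CI * L2norm Omega v.1].

Definition CDA_Picard_step (nu mu_nudge : R) (IH : vfield R d -> vfield R d)
    (f : vfield R d -> R) (uobs uk uk1 : h1field R d) :=
  forall v, V v ->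
    nu * L2dot Omega uk1.2 v.2 + b uk uk1 v
    + mu_nudge * L2dot Omega (IH uk1.1 - IH uobs.1) (IH v.1) = f v.1.

End spaces.

(* Main.v *)
Require Import Defs.
From mathcomp Require Import all_boot all_order all_algebra.
From mathcomp Require Import all_classical all_reals all_analysis.
From mathcomp Require Import measurable_realfun.
From mathcomp Require Import ring lra.
Import Order.TTheory GRing.Theory Num.Theory.
Import numFieldNormedType.Exports.
Local Open Scope classical_set_scope.
Local Open Scope ring_scope.
Set Implicit Arguments.
Unset Strict Implicit.
Unset Printing Implicit Defensive.

(** Write w = u + eps for the noisy observation, s = 1 + delta, U for the norm of
    f divided by nu, Y_k for the gradient norm of u_k and D_k for that of
    u_k - u_(k-1).

    Everything rests on b(u, v, v) = 0 for u in V and v in X (b_skew). Subtracting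
    two consecutive equations and testing with the increment, the nudging term is
    a square, and skew-symmetry leaves nu D_(k+1) <= M Y_k D_k
    (increment_estimate). It thus suffices that Y_k <= C_delta U eventually.
    For this the equation is tested with u_(k+1) - w (energy_estimate); with E the
    gradient norm of u_(k+1) - w,
      Y_(k+1)^2 + E^2 <= s^2 U^2 + 2 (U + alpha_delta Y_k) E.
    Completing the square removes E, and alpha_delta < 1/3 gives
      Y_(k+1)^2 <= (s^2 + 2) U^2 + (2/9) Y_k^2,
    a contraction whose fixed point (9/7) (s^2 + 2) U^2 is below
    (C_delta U)^2 = 4 (1 + s^2) U^2.

    Skew-symmetry is first shown for a test field phi, where the integrand is
    u . grad (|phi|^2 / 2); integrating by parts reduces the claim to
    int (div u) psi = 0 for test functions psi (divergence_test_orthogonal). The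
    constraint defining V only provides this for psi of mean zero, so psi is
    corrected by a multiple of an indicator function; on a domain of infinite
    measure the correction is made negligible by spreading it over large
    truncations. Density of test fields and the assumed bound on b give the
    general case. The analysis underneath is the vanishing of the integral of a
    partial derivative of a compactly supported function (integral_pderive0),
    proved by Fubini and the fundamental theorem of calculus. *)

(** * Borel structure of the space of row vectors *)

Section borel_rV.
Context (R : realType).

Lemma rV_ballE d (x y : 'rV[R]_d) (e : R) : 0 < e ->
  ball x e y <-> forall j, ball (x ord0 j) e (y ord0 j).
Proof.
move=> e0; split => [[_ h] j|h]; first exact: h.
by split => // i j; rewrite ord1; exact: h.
Qed.

Lemma measurable_rV_ball d (x : 'rV[R]_d) (e : R) : 0 < e ->
  measurable [set y : 'rV[R]_d | forall j, ball (x ord0 j) e (y ord0 j)].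
Proof.
move=> e0.
rewrite (_ : [set y | _] = \bigcap_(j in [set: 'I_d])
   ((fun y : 'rV[R]_d => y ord0 j) @^-1` ball (x ord0 j) e)); last first.
  by apply/seteqP; split => [y h j _|y h j]; [exact: h|exact: (h j I)].
apply: fin_bigcap_measurable => // j _.
rewrite -[X in measurable X]setTI; apply: measurable_coord => //.
by apply: open_measurable; apply: ball_open.
Qed.

(** The sigma-algebra on row vectors is generated by the coordinates; it contains
    the open sets because these are countable unions of open cubes with rational
    centres and radii 1/(n+1). *)
Lemma open_measurable_rV d (A : set 'rV[R]_d) : open A -> measurable A.
Proof.
move=> oA.
pose c (q : 'rV[rat]_d) : 'rV[R]_d := map_mx ratr q.
pose B (p : 'rV[rat]_d * nat) :=
  [set y : 'rV[R]_d | forall j, ball (c p.1 ord0 j) (p.2.+1%:R^-1 : R) (y ord0 j)].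
pose F p := if `[< B p `<=` A >] then B p else set0.
rewrite (_ : A = \bigcup_p F p).
  apply: countable_bigcupT_measurable; first exact: countableP.
  move=> p; rewrite /F; case: ifP => // _.
  by apply: measurable_rV_ball; rewrite invr_gt0 ltr0n.
apply/seteqP; split => [x Ax|x [p _]]; last first.
  by rewrite /F; case: ifPn => // /asboolP; apply.
have [e e0 eA] : exists2 e : R, 0 < e & ball x e `<=` A.
  by have := open_nbhs_nbhs (conj oA Ax) => /nbhs_ballP[e e0 eA]; exists e.
have [n ne] : exists n : nat, (n.+1%:R^-1 : R) < e / 2.
  have e20 : 0 < e / 2 by rewrite divr_gt0.
  by have [n] := ltr_add_invr e20; rewrite add0r => h; exists n.
have n0 : 0 < (n.+1%:R^-1 : R) by rewrite invr_gt0 ltr0n.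
have /choice[q qP] (j : 'I_d) : exists q : rat,
    ball (ratr q : R) n.+1%:R^-1 (x ord0 j).
  have [q] := @rat_in_itvoo R (x ord0 j - n.+1%:R^-1) (x ord0 j)
    ltac:(by rewrite ltrBlDr ltrDl).
  rewrite in_itv /= => /andP[q1 q2]; exists q; rewrite /ball /= ltr_distlC.
  by rewrite -ltrBlDr q1 andbT ltrBlDr (lt_trans q2)// ltrDl.
(* With q within 1/(n+1) < e/2 of x, the cube around q lies in the ball around
   x of radius e. *)
have BA : B (\row_j q j, n) `<=` A.
  move=> y By; apply: eA; apply/rV_ballE => // j.
  rewrite (splitr e); apply: (@ball_triangle _ _ (c (\row_j q j) ord0 j)).
    apply: (@le_ball _ _ _ n.+1%:R^-1); first exact: ltW.
    by apply: ball_sym; rewrite /c !mxE; exact: qP.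
  by apply: (@le_ball _ _ _ n.+1%:R^-1); [exact: ltW|exact: By].
exists (\row_j q j, n) => //; rewrite /F; case: ifPn => [_|/asboolP//] j /=.
by rewrite /c !mxE; exact: qP.
Qed.

Lemma continuous_measurable_rV d (f : 'rV[R]_d -> R) :
  continuous f -> measurable_fun setT f.
Proof.
move=> cf.
apply: (measurability _ (RGenOpens.measurableE R)).
move=> _ [_ [a [b ->]] <-]; rewrite setTI; apply: open_measurable_rV.
by move/continuousP: cf; apply; exact/interval_open.
Qed.

Definition cube d (r : R) : set 'rV[R]_d := [set x | forall j, `|x ord0 j| <= r].

Lemma measurable_cube d r : measurable (@cube d r).
Proof.
rewrite (_ : cube r = \bigcap_(j in [set: 'I_d])
   ((fun y : 'rV[R]_d => y ord0 j) @^-1` `[- r, r])); last first.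
  apply/seteqP; split => [y h j _|y h j] /=.
    by rewrite in_itv/= -ler_norml; exact: h.
  by have := h j I; rewrite /= in_itv/= -ler_norml.
apply: fin_bigcap_measurable => // j _.
by rewrite -[X in measurable X]setTI; apply: measurable_coord.
Qed.

Lemma compact_sub_cube d (K : set 'rV[R]_d) :
  compact K -> exists2 r, 0 < r & K `<=` cube r.
Proof.
move=> /compact_bounded[M [_ hM]].
exists (`|M| + 1); first by rewrite ltr_pwDr.
move=> x Kx j.
have := hM (`|M| + 1) ltac:(by rewrite (le_lt_trans (ler_norm M))// ltrDl) x Kx.
apply: le_trans.
by rewrite [leRHS]/Num.Def.normr /= mx_normrE; apply/bigmax_geP; right => /=; exists (ord0, j).
Qed.

Lemma rV_cons0 d (p : R * 'rV[R]_d) : rV_cons p ord0 ord0 = p.1.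
Proof.
rewrite /rV_cons (_ : ord0 = lshift d (ord0 : 'I_1)); last exact/val_inj.
by apply: (etrans (row_mxEl _ _ _ _)); rewrite mxE eqxx mulr1n.
Qed.

Lemma rV_consS d (p : R * 'rV[R]_d) j : rV_cons p ord0 (lift ord0 j) = p.2 ord0 j.
Proof.
rewrite /rV_cons (_ : lift ord0 j = rshift 1 j); last exact/val_inj.
exact: row_mxEr.
Qed.

Lemma lebesgue_cube_lty d (r : R) : (lebesgue_rV R d (cube r) < +oo)%E.
Proof.
elim: d => [|d ih]; first by rewrite /= diracE; case: (_ \in _) => //=; rewrite ltry.
rewrite /= /lebesgue_cons /pushforward.
rewrite (_ : _ @^-1` _ = `[- r, r] `*` cube r); last first.
  apply/seteqP; split => [[a x] h|[a x] [/= ha hx]].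
    split => /=; first by have := h ord0; rewrite rV_cons0 /= in_itv/= -ler_norml.
    by move=> j; have := h (lift ord0 j); rewrite rV_consS.
  move=> j; have [i ->|->] := unliftP ord0 j; first by rewrite rV_consS; exact: hx.
  by rewrite rV_cons0/=; move: ha; rewrite in_itv/= -ler_norml.
rewrite product_measure1E//; last exact: measurable_cube.
apply: lte_mul_pinfty => //.
have /= -> := @lebesgue_measure_itv R `[- r, r]; case: ifP => // _; rewrite -EFinB.
Qed.

End borel_rV.

(** * Integrals of partial derivatives of compactly supported functions *)

Section pderive_integral.
Context (R : realType).

(** Directional derivatives only see the restriction of the function to a
    line, which is what turns a partial derivative on a slice into an ordinary
    or lower-dimensional one. *)
Lemma derive_line (V V' W : normedModType R) (f : V -> W) (f' : V' -> W)
    (a v : V) (a' v' : V') :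
  (forall h : R, f (h *: v + a) = f' (h *: v' + a')) ->
  (derivable f a v <-> derivable f' a' v') /\ 'D_v f a = 'D_v' f' a'.
Proof.
move=> ff.
have faa : f a = f' a' by have := ff 0; rewrite !scale0r !add0r.
have E : (fun h : R => h^-1 *: ((f \o shift a) (h *: v) - f a)) =
         (fun h : R => h^-1 *: ((f' \o shift a') (h *: v') - f' a')).
  by apply/funext => h /=; rewrite ff faa.
by rewrite /derivable /derive E.
Qed.

Lemma pderive_support d (j : 'I_d) (g : 'rV[R]_d -> R) (K : set 'rV[R]_d) :
  closed K -> (forall x, ~ K x -> g x = 0) ->
  forall x, ~ K x -> pderive j g x = 0.
Proof.
move=> cK g0 x Kx; rewrite /pderive.
rewrite (@near_eq_derive _ _ _ g (cst 0)) ?derive_cst//.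
have /closed_openC oK := cK.
have : nbhs x (~` K) by exact: open_nbhs_nbhs.
by apply: filterS => y /g0.
Qed.

Lemma compact_cube d r : compact (@cube R d r).
Proof.
rewrite (_ : cube r = [set v : 'rV[R]_d | forall i, `[- r, r]%classic (v ord0 i)]).
  apply: (@rV_compact _ _ (fun=> `[- r, r]%classic)) => _.
  exact: segment_compact.
by apply/seteqP; split => x h j; have := h j; rewrite /= in_itv/= -ler_norml.
Qed.

Lemma closed_cube d r : closed (@cube R d r).
Proof.
by apply: compact_closed; [exact: norm_hausdorff|exact: compact_cube].
Qed.

Lemma integrable_supported d (h : 'rV[R]_d -> R) r :
  continuous h -> (forall x, ~ cube r x -> h x = 0) ->
  (lebesgue_rV R d).-integrable setT (EFin \o h).
Proof.
move=> ch h0.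
have [C hC] : exists C, forall x, cube r x -> `|h x| <= C.
  have : compact (h @` cube r).
    apply: continuous_compact; last exact: compact_cube.
    exact: continuous_subspaceT.
  move=> /compact_bounded[M [_ hM]]; exists (`|M| + 1) => x rx.
  apply: (hM (`|M| + 1)); last by exists x.
  by rewrite (le_lt_trans (ler_norm M))// ltrDl.
apply: (@le_integrable _ _ _ _ _ _ _ (fun x => (C * \1_(cube r) x)%:E)) => //.
- by apply/measurable_EFinP; exact: continuous_measurable_rV.
- move=> x _; rewrite /= lee_fin; have [rx|rx] := pselect (cube r x).
    by rewrite indicE mem_set// mulr1 (le_trans (hC _ rx))// ler_norm.
  by rewrite h0// normr0 normr_ge0.
- under eq_fun do rewrite EFinM.
  apply: integrableZl => //.
  apply/integrableP; split.
    by apply/measurable_EFinP; apply: measurable_indic; exact: measurable_cube.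
  rewrite (eq_integral (fun x => (\1_(cube r) x)%:E)); last first.
    by move=> x _ /=; rewrite ger0_norm.
  rewrite integral_indic//; last exact: measurable_cube.
  by rewrite setIT; exact: lebesgue_cube_lty.
Qed.

Lemma continuous_rV_cons_l d (y : 'rV[R]_d) :
  continuous (fun a : R => rV_cons (a, y)).
Proof.
move=> a.
suff H e : 0 < e -> nbhs a (fun b => ball (rV_cons (a, y)) e (rV_cons (b, y))).
  move=> A /nbhs_ballP[e e0 eA].
  exact: filterS (fun _ h => eA _ h) (H e e0).
move=> e0; apply: filterS (nbhsx_ballx a e e0) => b ab.
apply/rV_ballE => // j; have [i ->|->] := unliftP ord0 j.
  by rewrite !rV_consS; exact: ballxx.
by rewrite !rV_cons0.
Qed.

Lemma continuous_rV_cons_r d (a : R) :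
  continuous (fun y : 'rV[R]_d => rV_cons (a, y)).
Proof.
move=> y.
suff H e : 0 < e -> nbhs y (fun z => ball (rV_cons (a, y)) e (rV_cons (a, z))).
  move=> A /nbhs_ballP[e e0 eA].
  exact: filterS (fun _ h => eA _ h) (H e e0).
move=> e0; apply: filterS (nbhsx_ballx y e e0) => z /(rV_ballE _ _ e0) yz.
apply/rV_ballE => // j; have [i ->|->] := unliftP ord0 j.
  by rewrite !rV_consS; exact: yz.
by rewrite !rV_cons0; exact: ballxx.
Qed.

Lemma rV_lineE d (h : R) (k : 'I_d) (x : 'rV[R]_d) j :
  (h *: delta_mx ord0 k + x) ord0 j = h * (j == k)%:R + x ord0 j.
Proof. by rewrite !mxE. Qed.

Lemma rV_cons_shift0 d (a h : R) (y : 'rV[R]_d) :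
  h *: delta_mx ord0 ord0 + rV_cons (a, y) = rV_cons (h *: 1 + a, y).
Proof.
apply/rowP => j; rewrite rV_lineE; have [i ->|->] := unliftP ord0 j.
  by rewrite !rV_consS eq_sym (negbTE (neq_lift _ _)) mulr0 add0r.
by rewrite !rV_cons0 eqxx.
Qed.

Lemma rV_cons_shiftS d (a h : R) (y : 'rV[R]_d) i :
  h *: delta_mx ord0 (lift ord0 i) + rV_cons (a, y)
  = rV_cons (a, h *: delta_mx ord0 i + y).
Proof.
apply/rowP => j; rewrite rV_lineE; have [k ->|->] := unliftP ord0 j.
  rewrite !rV_consS /= rV_lineE.
  by rewrite (inj_eq (@lift_inj _ ord0)).
by rewrite !rV_cons0 (negbTE (neq_lift _ _)) mulr0 add0r.
Qed.

Lemma cube_cons d r (p : R * 'rV[R]_d) :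
  cube r (rV_cons p) <-> `|p.1| <= r /\ cube r p.2.
Proof.
split=> [h|[h1 h2] j].
  split; first by have := h ord0; rewrite rV_cons0.
  by move=> j; have := h (lift ord0 j); rewrite rV_consS.
by have [k ->|->] := unliftP ord0 j; rewrite ?rV_cons0 ?rV_consS//; exact: h2.
Qed.

Lemma integral_derive_supported (F : R -> R) (r : R) :
  0 < r -> (forall x, derivable F x 1) -> continuous (derive1 F) ->
  (forall x, r < `|x| -> F x = 0) -> (forall x, r < `|x| -> derive1 F x = 0) ->
  (\int[@lebesgue_measure R]_x (derive1 F x)%:E = 0)%E.
Proof.
move=> r0 dF cF F0 F'0.
have cF0 : continuous F.
  by move=> x; apply: differentiable_continuous; apply/derivable1_diffP.
(* The margin 1 puts both endpoints outside the support. *)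
transitivity (\int[@lebesgue_measure R]_(x in `[(- (r + 1))%R, (r + 1)%R]) (derive1 F x)%:E)%E.
  rewrite [RHS]integral_mkcond; apply: eq_integral => x _.
  rewrite patchE; case: ifPn => // /negP xr; rewrite F'0// ltNge.
  apply/negP => xr'; apply: xr; rewrite inE /= in_itv/= -ler_norml.
  by rewrite (le_trans xr')// lerDl.
rewrite (continuous_FTC2 (F := F)).
- rewrite !F0 ?subee// ?normrN ger0_norm ?ltrDl// addr_ge0//; exact: ltW.
- by rewrite gtrN// addr_gt0.
- exact: continuous_subspaceT.
- split; [by []| |].
  + exact/cvg_at_right_filter/cF0.
  + exact/cvg_at_left_filter/cF0.
- by [].
Qed.

(** Fubini reduces this to the fundamental theorem of calculus in the
    variable of differentiation: coordinates are peeled off one at a time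
    until that variable is the leading one. *)
Lemma integral_pderive0 d (j : 'I_d) (g : 'rV[R]_d -> R) r : 0 < r ->
  continuous g -> (forall x, derivable g x (delta_mx ord0 j)) ->
  continuous (pderive j g) -> (forall x, ~ cube r x -> g x = 0) ->
  (\int[lebesgue_rV R d]_x (pderive j g x)%:E = 0)%E.
Proof.
move=> r0; elim: d => [|d ih] in j g *; first by case: j.
move=> cg dg cdg g0.
have dg0 := pderive_support j (closed_cube (r:=r)) g0.
have ig := integrable_supported cdg dg0.
pose f : measurableTypeR R * 'rV[R]_d -> R := pderive j g \o (@rV_cons R d).
have mc := @measurable_rV_cons R d.
have ifc : (lebesgue_measure \x lebesgue_rV R d)%E.-integrable setT (EFin \o f).
  apply/integrableP; split.
    apply/measurable_EFinP; apply: measurableT_comp => //.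
    exact: continuous_measurable_rV.
  move/integrableP : ig => [_].
  rewrite /= /lebesgue_cons ge0_integral_pushforward ?preimage_setT//.
  apply/measurable_EFinP; apply: measurableT_comp => //.
  exact: continuous_measurable_rV.
transitivity (\int[(lebesgue_measure \x lebesgue_rV R d)%E]_p (EFin \o f) p)%E.
  have := @integral_pushforward _ _ _ _ R _ mc
    (lebesgue_measure \x lebesgue_rV R d)%E setT (EFin \o pderive j g).
  rewrite preimage_setT; apply => //.
  by apply/measurable_EFinP; exact: continuous_measurable_rV.
have [i ji|ji] := unliftP ord0 j; subst j.
- rewrite -integral12_prod_meas1//.
  rewrite (eq_integral (cst 0%E)) ?integral0// => a _.
  rewrite /fubini_F /= /f /=.
  have E y := @derive_line _ _ _ g (fun y => g (rV_cons (a, y))) (rV_cons (a, y))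
    (delta_mx ord0 (lift ord0 i)) y (delta_mx ord0 i) (fun h => congr1 g (rV_cons_shiftS a h y i)).
  pose G y := g (rV_cons (a, y)).
  have E1 : pderive i G = fun y => pderive (lift ord0 i) g (rV_cons (a, y)).
    by apply/funext => y; exact/esym/(E y).2.
  rewrite -[RHS](ih i G); first by rewrite E1.
  + by move=> y; apply: continuous_comp; [exact: continuous_rV_cons_r|exact: cg].
  + move=> y; exact: (E y).1.1 (dg (rV_cons (a, y))).
  + rewrite E1 => y.
    apply: (@continuous_comp _ _ _ (fun y => rV_cons (a, y))
      (pderive (lift ord0 i) g));
      [exact: continuous_rV_cons_r|exact: cdg].
  + by move=> y ry; apply: g0 => /cube_cons[].
- rewrite -integral21_prod_meas1//.
  rewrite (eq_integral (cst 0%E)) ?integral0// => y _.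
  rewrite /fubini_G /= /f /=.
  have E a := @derive_line _ _ _ g (fun a => g (rV_cons (a, y))) (rV_cons (a, y))
    (delta_mx ord0 ord0) a (1 : R) (fun h => congr1 g (rV_cons_shift0 a h y)).
  pose G a := g (rV_cons (a, y)).
  transitivity (\int[@lebesgue_measure R]_a (derive1 G a)%:E)%E.
    by apply: eq_integral => a _; congr EFin; rewrite derive1E; exact: (E a).2.
  have E1 : derive1 G = fun a => pderive ord0 g (rV_cons (a, y)).
    by apply/funext => a; rewrite derive1E; exact/esym/(E a).2.
  apply: (integral_derive_supported r0).
  + move=> a; exact: (E a).1.1 (dg (rV_cons (a, y))).
  + rewrite E1 => a.
    apply: (@continuous_comp _ _ _ (fun a => rV_cons (a, y)) (pderive ord0 g));
      [exact: continuous_rV_cons_l|exact: cdg].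
  + by move=> a ra; apply: g0 => /cube_cons[/= h _]; rewrite leNgt ra in h.
  + move=> a ra; rewrite E1; apply: dg0 => /cube_cons[/= h _].
    by rewrite leNgt ra in h.
Qed.

End pderive_integral.

(** * The Hilbert space structure of square-integrable fields *)

Section L2_theory.
Context (R : realType) (d : nat) (Omega : set 'rV[R]_d).
Hypothesis mOmega : measurable Omega.
Let mu := lebesgue_rV R d.

(** Domination by f^2 + g^2. *)
Lemma square_integrableM (f g : 'rV[R]_d -> R) :
  square_integrable Omega f -> square_integrable Omega g ->
  mu.-integrable Omega (EFin \o (fun x => f x * g x)).
Proof.
move=> [mf jf] [mg ig].
have ifg := integrableD mOmega jf ig.
apply: le_integrable ifg => //.
  by apply/measurable_EFinP; exact: measurable_funM.
move=> x _ /=; rewrite lee_fin ler_norml ger0_norm ?addr_ge0 ?sqr_ge0//.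
by have := sqr_ge0 (f x + g x); have := sqr_ge0 (f x - g x); nra.
Qed.

Lemma square_integrableZD (a : R) (f g : 'rV[R]_d -> R) :
  square_integrable Omega f -> square_integrable Omega g ->
  square_integrable Omega (fun x => a * f x + g x).
Proof.
move=> [mf jf] [mg ig].
have mh : measurable_fun Omega (fun x => a * f x + g x).
  by apply: measurable_funD => //; exact: measurable_funM.
split=> //.
have ifg := integrableD mOmega (integrableZl mOmega (2 * a ^+ 2) jf)
                               (integrableZl mOmega 2 ig).
apply: le_integrable ifg => //.
  by apply/measurable_EFinP; exact: measurable_funX.
move=> x _ /=; rewrite lee_fin !ger0_norm ?sqr_ge0//; last first.
  by have := sqr_ge0 (a * f x); have := sqr_ge0 (g x); rewrite exprMn; lra.
by have := sqr_ge0 (a * f x - g x); nra.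
Qed.

Lemma square_integrable0 : square_integrable Omega (fun=> 0 : R).
Proof.
split; first exact: measurable_cst.
by rewrite expr0n/=; exact: integrable0.
Qed.

Lemma integrable_sumR (I : Type) (s : seq I) (f : I -> 'rV[R]_d -> R) :
  (forall i, mu.-integrable Omega (EFin \o f i)) ->
  mu.-integrable Omega (EFin \o (fun x => \sum_(i <- s) f i x)).
Proof.
move=> sf.
rewrite (_ : _ \o _ = fun x => (\sum_(i <- s) (f i x)%:E)%E).
  exact: (@integrable_sum _ _ _ mu _ mOmega _ s xpredT (fun i => EFin \o f i)).
by apply/funext => x /=; rewrite sumEFin.
Qed.

Section mxdot.
Context (m n : nat).
Implicit Types (A B C : 'M[R]_(m, n)) (F G K : 'rV[R]_d -> 'M[R]_(m, n)).

Lemma mxdotC A B : mxdot A B = mxdot B A.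
Proof. by apply: eq_bigr => i _; apply: eq_bigr => j _; rewrite mulrC. Qed.

Lemma mxdotDl A B C : mxdot (A + B) C = mxdot A C + mxdot B C.
Proof.
rewrite /mxdot -big_split; apply: eq_bigr => i _ /=.
by rewrite -big_split; apply: eq_bigr => j _; rewrite /= mxE mulrDl.
Qed.

Lemma mxdotZl a A C : mxdot (a *: A) C = a * mxdot A C.
Proof.
rewrite /mxdot mulr_sumr; apply: eq_bigr => i _.
by rewrite mulr_sumr; apply: eq_bigr => j _; rewrite mxE mulrA.
Qed.

Lemma mxdot_ge0 A : 0 <= mxdot A A.
Proof. by do 2 (apply: sumr_ge0 => ? _); rewrite -expr2 sqr_ge0. Qed.

Lemma L2ZD a F G : L2 Omega F -> L2 Omega G -> L2 Omega (a *: F + G).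
Proof.
move=> lF lG i j.
rewrite (_ : (fun x => _) = fun x => a * F x i j + G x i j).
  exact: square_integrableZD.
by apply/funext => x; rewrite !mxE.
Qed.

Lemma L20 : L2 Omega (0 : 'rV[R]_d -> 'M[R]_(m, n)).
Proof.
move=> i j; rewrite (_ : (fun x => _) = fun=> 0); first exact: square_integrable0.
by apply/funext => x; rewrite mxE.
Qed.

Lemma L2D F G : L2 Omega F -> L2 Omega G -> L2 Omega (F + G).
Proof. by move=> lF lG; rewrite -[F]scale1r; exact: L2ZD. Qed.

Lemma L2Z a F : L2 Omega F -> L2 Omega (a *: F).
Proof. by move=> lF; rewrite -[_ *: _]addr0; apply: L2ZD => //; exact: L20. Qed.

Lemma L2B F G : L2 Omega F -> L2 Omega G -> L2 Omega (F - G).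
Proof. by move=> lF lG; rewrite addrC -scaleN1r; exact: L2ZD. Qed.

Lemma integrable_mxdot F G : L2 Omega F -> L2 Omega G ->
  mu.-integrable Omega (EFin \o (fun x => mxdot (F x) (G x))).
Proof.
move=> lF lG; apply: integrable_sumR => i; apply: integrable_sumR => j.
exact: square_integrableM.
Qed.

Lemma L2dotC F G : L2dot Omega F G = L2dot Omega G F.
Proof. by apply: eq_Rintegral => x _; rewrite mxdotC. Qed.

Lemma L2dotDl F G K : L2 Omega F -> L2 Omega G -> L2 Omega K ->
  L2dot Omega (F + G) K = L2dot Omega F K + L2dot Omega G K.
Proof.
move=> lF lG lK; rewrite /L2dot -RintegralD//; try exact: integrable_mxdot.
by apply: eq_Rintegral => x _; rewrite -mxdotDl.
Qed.

Lemma L2dotZl a F K : L2 Omega F -> L2 Omega K ->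
  L2dot Omega (a *: F) K = a * L2dot Omega F K.
Proof.
move=> lF lK; rewrite /L2dot -RintegralZl//; try exact: integrable_mxdot.
by apply: eq_Rintegral => x _; rewrite -mxdotZl.
Qed.

Lemma L2dotNl F K : L2 Omega F -> L2 Omega K ->
  L2dot Omega (- F) K = - L2dot Omega F K.
Proof. by move=> lF lK; rewrite -scaleN1r L2dotZl// mulN1r. Qed.

Lemma L2dotBl F G K : L2 Omega F -> L2 Omega G -> L2 Omega K ->
  L2dot Omega (F - G) K = L2dot Omega F K - L2dot Omega G K.
Proof.
move=> lF lG lK; rewrite L2dotDl ?L2dotNl// -scaleN1r; exact: L2Z.
Qed.

Lemma L2dotBr F G K : L2 Omega F -> L2 Omega G -> L2 Omega K ->
  L2dot Omega K (F - G) = L2dot Omega K F - L2dot Omega K G.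
Proof. by move=> lF lG lK; rewrite L2dotC L2dotBl// !(L2dotC K). Qed.

Lemma L2dot_ge0 F : 0 <= L2dot Omega F F.
Proof. by apply: Rintegral_ge0 => x _; exact: mxdot_ge0. Qed.

Lemma L2norm_ge0 F : 0 <= L2norm Omega F.
Proof. exact: sqrtr_ge0. Qed.

Lemma sqr_L2norm F : L2norm Omega F ^+ 2 = L2dot Omega F F.
Proof. by rewrite sqr_sqrtr// L2dot_ge0. Qed.

Lemma L2dot_ZDZD a F b G : L2 Omega F -> L2 Omega G ->
  L2dot Omega (a *: F + b *: G) (a *: F + b *: G) =
  a ^+ 2 * L2dot Omega F F + 2 * a * b * L2dot Omega F G
    + b ^+ 2 * L2dot Omega G G.
Proof.
move=> lF lG; have laF := L2Z a lF; have lbG := L2Z b lG.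
have l := L2D laF lbG.
rewrite L2dotDl// !L2dotZl// (L2dotC F) (L2dotC G) !L2dotDl// !L2dotZl//.
by rewrite (L2dotC G F); ring.
Qed.

(** Cauchy-Schwarz, from the nonnegativity of the form aF + bG at well-chosen
    coefficients. *)
Lemma le_L2dot F G : L2 Omega F -> L2 Omega G ->
  L2dot Omega F G <= L2norm Omega F * L2norm Omega G.
Proof.
move=> lF lG.
pose p := L2norm Omega F; pose q := L2norm Omega G; pose c := L2dot Omega F G.
have p0 : 0 <= p := L2norm_ge0 F.
have q0 : 0 <= q := L2norm_ge0 G.
have Q a b : 0 <= a ^+ 2 * p ^+ 2 + 2 * a * b * c + b ^+ 2 * q ^+ 2.
  by rewrite !sqr_L2norm -L2dot_ZDZD//; exact: L2dot_ge0.
rewrite -/p -/q -/c leNgt; apply/negP => pqc.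
have [p00|p00] := eqVneq p 0.
  (* F is null, so the form is affine in a with slope proportional to c: it takes
     negative values unless c = 0. *)
  have := Q ((1 + q ^+ 2) / c) (-1).
  rewrite p00 mul0r in pqc.
  rewrite p00 (_ : _ + _ = - 2 - q ^+ 2); last first.
    by field; rewrite gt_eqF.
  by move: (sqr_ge0 q); nra.
have pp : 0 < p by rewrite lt_neqAle eq_sym p00.
(* These coefficients give a multiple of the component of G orthogonal to F. *)
have := Q c (- p ^+ 2).
rewrite (_ : _ + _ = p ^+ 2 * ((p * q) ^+ 2 - c ^+ 2)); last by ring.
rewrite pmulr_rge0 ?exprn_gt0// subr_ge0 => h.
have c0 : 0 <= c by rewrite (le_trans _ (ltW pqc))// mulr_ge0.
by move: h; rewrite ler_pXn2r ?nnegrE ?mulr_ge0// leNgt pqc.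
Qed.

Lemma L2normN F : L2norm Omega (- F) = L2norm Omega F.
Proof.
congr Num.sqrt; apply: eq_Rintegral => x _.
by rewrite /mxdot; apply: eq_bigr => i _; apply: eq_bigr => j _; rewrite !mxE mulrNN.
Qed.

Lemma L2normBC F G : L2norm Omega (F - G) = L2norm Omega (G - F).
Proof. by rewrite -L2normN opprB. Qed.

Lemma L2norm0 : L2norm Omega (0 : 'rV[R]_d -> 'M[R]_(m, n)) = 0.
Proof.
have := sqr_L2norm (0 : 'rV[R]_d -> 'M[R]_(m, n)).
rewrite -(scale0r 0) L2dotZl ?scale0r; try exact: L20.
by rewrite mul0r => /eqP; rewrite sqrf_eq0 => /eqP.
Qed.

Lemma ler_abs_L2dot F G : L2 Omega F -> L2 Omega G ->
  `|L2dot Omega F G| <= L2norm Omega F * L2norm Omega G.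
Proof.
move=> lF lG; rewrite ler_norml le_L2dot// andbT lerNl -L2dotNl// -(L2normN F).
by apply: le_L2dot => //; rewrite -scaleN1r; exact: L2Z.
Qed.

Lemma ler_L2normD F G : L2 Omega F -> L2 Omega G ->
  L2norm Omega (F + G) <= L2norm Omega F + L2norm Omega G.
Proof.
move=> lF lG; have lFG := L2D lF lG.
rewrite -(@ler_pXn2r _ 2) ?nnegrE ?addr_ge0 ?L2norm_ge0//.
rewrite sqr_L2norm -[F]scale1r -[G]scale1r L2dot_ZDZD// !scale1r -!sqr_L2norm.
have := le_L2dot lF lG; lra.
Qed.

Lemma L2normZ a F : L2 Omega F -> L2norm Omega (a *: F) = `|a| * L2norm Omega F.
Proof.
move=> lF; have laF := L2Z a lF; rewrite /L2norm.
have -> : L2dot Omega (a *: F) (a *: F) = a ^+ 2 * L2dot Omega F F.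
  by rewrite (L2dotZl a lF laF) L2dotC (L2dotZl a lF lF) mulrA.
by rewrite sqrtrM ?sqr_ge0// sqrtr_sqr.
Qed.

Lemma L2norm_le_near F G : L2 Omega F -> L2 Omega G ->
  L2norm Omega F <= L2norm Omega G + L2norm Omega (F - G).
Proof.
move=> lF lG; have := ler_L2normD lG (L2B lF lG).
by rewrite addrC subrK.
Qed.

(** The interpolation operator is linear only almost everywhere, so its linearity
    is used through this lemma. *)
Lemma ae_eq_L2dot F G K : L2 Omega F -> L2 Omega G -> L2 Omega K ->
  {ae mu, forall x, Omega x -> F x = G x} ->
  L2dot Omega F K = L2dot Omega G K.
Proof.
move=> lF lG lK FG; congr fine; apply: ae_eq_integral => //.
- by have /integrableP[] := integrable_mxdot lF lK.
- by have /integrableP[] := integrable_mxdot lG lK.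
- by apply: filterS FG => x h /h ->.
Qed.

End mxdot.
End L2_theory.

(** * Smooth functions and test functions *)

Section smooth_functions.
Context (R : realType) (d : nat).
Implicit Types (f g : 'rV[R]_d -> R) (j : 'I_d).

(** Smoothness quantifies over all iterated derivatives; exhibiting a class of
    functions stable under each partial derivative avoids a closed formula for
    the iterates. *)
Lemma smooth_coind (C : ('rV[R]_d -> R) -> Prop) :
  (forall g, C g -> continuous g /\ forall j,
     (forall x, derivable g x (delta_mx ord0 j)) /\ C (pderive j g)) ->
  forall g, C g -> smooth g.
Proof.
move=> HC g Cg.
have Cs s : C (foldr (@pderive R d) g s).
  by elim: s => //= j s /HC[_ /(_ j)[]].
by move=> s; have [cs ds] := HC _ (Cs s); split=> // j x; have [] := ds j.
Qed.

Lemma smooth_continuous g : smooth g -> continuous g.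
Proof. by move=> /(_ [::])[]. Qed.

Lemma smooth_derivable g j x : smooth g -> derivable g x (delta_mx ord0 j).
Proof. by move=> /(_ [::])[]. Qed.

Lemma smooth_pderive g j : smooth g -> smooth (pderive j g).
Proof. by move=> sg s; have := sg (rcons s j); rewrite foldr_rcons. Qed.

Lemma smooth0 : smooth (fun _ : 'rV[R]_d => 0 : R).
Proof.
apply: (@smooth_coind (fun g => g = (fun _ : 'rV[R]_d => 0 : R))) => // g ->; split.
  exact: cst_continuous.
move=> j; split; first by move=> x; exact: derivable_cst.
by apply/funext => x; rewrite /pderive derive_cst.
Qed.

Lemma pderiveZD a f g j : smooth f -> smooth g ->
  pderive j (fun x => a * f x + g x) = fun x => a * pderive j f x + pderive j g x.
Proof.
move=> sf sg; apply/funext => x; rewrite /pderive.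
have df : derivable f x (delta_mx ord0 j) by exact: smooth_derivable.
have dg : derivable g x (delta_mx ord0 j) by exact: smooth_derivable.
have daf : derivable (a *: f) x (delta_mx ord0 j) by exact: derivableZ.
have e : 'D_(delta_mx ord0 j) (a *: f + g) x = 'D_(delta_mx ord0 j) (a *: f) x
  + 'D_(delta_mx ord0 j) g x := deriveD daf dg.
by rewrite (deriveZ a df) in e; exact: e.
Qed.

Lemma smoothZD a f g : smooth f -> smooth g -> smooth (fun x => a * f x + g x).
Proof.
move=> sf sg.
pose C h := exists f' g', [/\ smooth f', smooth g' & h = fun x => a * f' x + g' x].
apply: (@smooth_coind C); last by exists f, g.
move=> _ [f1 [g1 [sf1 sg1 ->]]]; split.
  move=> x; apply: (@continuousD _ _ _ (fun x => a * f1 x) g1).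
    apply: (@continuousM _ _ (cst a) f1); first exact: cst_continuous.
    exact: smooth_continuous.
  exact: smooth_continuous.
move=> j; split.
  move=> x; apply: (@derivableD _ _ _ (a *: f1) g1); last exact: smooth_derivable.
  by apply: derivableZ; exact: smooth_derivable.
exists (pderive j f1), (pderive j g1).
by split; [exact: smooth_pderive|exact: smooth_pderive|exact: pderiveZD].
Qed.

Lemma pderiveM f g j : smooth f -> smooth g ->
  pderive j (fun x => f x * g x) = fun x => f x * pderive j g x + pderive j f x * g x.
Proof.
move=> sf sg; apply/funext => x; rewrite /pderive.
have df : derivable f x (delta_mx ord0 j) by exact: smooth_derivable.
have dg : derivable g x (delta_mx ord0 j) by exact: smooth_derivable.
have e := deriveM df dg.
by apply: (etrans e); rewrite [X in _ + X]mulrC.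
Qed.

(** Products of two smooth functions alone are not stable under derivatives; by
    the Leibniz rule, their finite sums are. *)
Inductive smooth_span : ('rV[R]_d -> R) -> Prop :=
| smooth_spanM f g : smooth f -> smooth g -> smooth_span (fun x => f x * g x)
| smooth_spanD f g : smooth_span f -> smooth_span g ->
    smooth_span (fun x => f x + g x).

Lemma smoothM f g : smooth f -> smooth g -> smooth (fun x => f x * g x).
Proof.
move=> sf sg; apply: (@smooth_coind smooth_span); last exact: smooth_spanM.
move=> h; elim=> {h} [f1 g1 sf1 sg1|f1 g1 _ [cf1 ihf1] _ [cg1 ihg1]].
  split; first by move=> x; apply: (@continuousM _ _ f1 g1); exact: smooth_continuous.
  move=> j; split.
    by move=> x; apply: (@derivableM _ _ f1 g1); exact: smooth_derivable.
  rewrite pderiveM//.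
  exact: (smooth_spanD (smooth_spanM sf1 (smooth_pderive j sg1))
                       (smooth_spanM (smooth_pderive j sf1) sg1)).
split; first by move=> x; apply: (@continuousD _ _ _ f1 g1); [exact: cf1|exact: cg1].
move=> j; have [df1 Cf1] := ihf1 j; have [dg1 Cg1] := ihg1 j; split.
  by move=> x; apply: (@derivableD _ _ _ f1 g1); [exact: df1|exact: dg1].
rewrite (_ : pderive j _ = fun x => pderive j f1 x + pderive j g1 x).
  exact: smooth_spanD.
by apply/funext => x; rewrite /pderive -deriveD.
Qed.

Context (Omega : set 'rV[R]_d).

Lemma test_fun0 : test_fun Omega (fun _ : 'rV[R]_d => 0 : R).
Proof.
by split; [exact: smooth0|exists set0; split=> //; exact: compact0].
Qed.

Lemma test_funZD a f g :
  test_fun Omega f -> test_fun Omega g -> test_fun Omega (fun x => a * f x + g x).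
Proof.
move=> [sf [K [cK KO f0]]] [sg [L [cL LO g0]]]; split; first exact: smoothZD.
exists (K `|` L); split; [exact: compactU|by rewrite subUset|].
by move=> x /not_orP[Kx Lx]; rewrite f0// g0// mulr0 addr0.
Qed.

Lemma test_funMr f g : smooth f -> test_fun Omega g ->
  test_fun Omega (fun x => f x * g x).
Proof.
move=> sf [sg [K [cK KO g0]]]; split; first exact: smoothM.
by exists K; split => // x /g0 ->; rewrite mulr0.
Qed.

Lemma test_fun_pderive g j : test_fun Omega g -> test_fun Omega (pderive j g).
Proof.
move=> [sg [K [cK KO g0]]]; split; first exact: smooth_pderive.
exists K; split => //; apply: pderive_support => //.
by apply: compact_closed => //; exact: norm_hausdorff.
Qed.

Lemma test_fun_sum (I : Type) (s : seq I) (f : I -> 'rV[R]_d -> R) :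
  (forall i, test_fun Omega (f i)) -> test_fun Omega (fun x => \sum_(i <- s) f i x).
Proof.
move=> tf; elim: s => [|i s ih].
  by under eq_fun do rewrite big_nil; exact: test_fun0.
under eq_fun do rewrite big_cons -[f i _]mul1r.
exact: test_funZD.
Qed.

Let mu := lebesgue_rV R d.

Lemma test_fun_measurable g : test_fun Omega g -> measurable_fun Omega g.
Proof.
move=> [sg _]; apply: measurable_funTS.
by apply: continuous_measurable_rV; exact: smooth_continuous.
Qed.

Lemma test_fun_integrableT g : test_fun Omega g -> mu.-integrable setT (EFin \o g).
Proof.
move=> [sg [K [cK KO g0]]]; have [r r0 Kr] := compact_sub_cube cK.
apply: (@integrable_supported _ _ _ r); first exact: smooth_continuous.
by move=> x rx; apply: g0 => /Kr.
Qed.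

Hypothesis mOmega : measurable Omega.

Lemma test_fun_integrable g : test_fun Omega g -> mu.-integrable Omega (EFin \o g).
Proof. by move=> /test_fun_integrableT; exact: integrableS. Qed.

Lemma test_fun_square_integrable g : test_fun Omega g -> square_integrable Omega g.
Proof.
move=> tg; split; first exact: test_fun_measurable.
have [sg _] := tg; have := test_fun_integrable (test_funMr sg tg).
by rewrite /comp; under eq_fun do rewrite -expr2.
Qed.

Lemma test_fun_Rintegral g : test_fun Omega g ->
  \int[mu]_(x in Omega) g x = \int[mu]_x g x.
Proof.
move=> [_ [K [cK KO g0]]]; rewrite Rintegral_mkcond; apply: eq_Rintegral => x _.
by rewrite patchE; case: ifPn => // /negP xO; rewrite g0// => /KO Ox; apply: xO; rewrite inE.
Qed.

(** The integral over Omega is one over the whole space because the support is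
    a compact subset of Omega; no boundary term can appear. *)
Lemma test_fun_int_pderive0 g j : test_fun Omega g ->
  \int[mu]_(x in Omega) pderive j g x = 0.
Proof.
move=> tg; rewrite test_fun_Rintegral; last exact: test_fun_pderive.
have [sg [K [cK KO g0]]] := tg; have [r r0 Kr] := compact_sub_cube cK.
rewrite /Rintegral (integral_pderive0 r0)//.
- exact: smooth_continuous.
- by move=> x; exact: smooth_derivable.
- exact/smooth_continuous/smooth_pderive.
- by move=> x rx; apply: g0 => /Kr.
Qed.

Lemma test_fun_by_parts f g j : smooth f -> test_fun Omega g ->
  \int[mu]_(x in Omega) (f x * pderive j g x) =
  - \int[mu]_(x in Omega) (pderive j f x * g x).
Proof.
move=> sf tg; have [sg _] := tg.
have := test_fun_int_pderive0 j (test_funMr sf tg).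
rewrite pderiveM// RintegralD//; first by move/eqP; rewrite addr_eq0 => /eqP.
- exact/test_fun_integrable/test_funMr/test_fun_pderive.
- exact/test_fun_integrable/test_funMr/tg/smooth_pderive.
Qed.

End smooth_functions.

(** * The spaces X and V *)

Section spaces_theory.
Context (R : realType) (d : nat) (Omega : set 'rV[R]_d).
Hypothesis mOmega : measurable Omega.
Let mu := lebesgue_rV R d.

Lemma RintegralZD (a : R) (f g : 'rV[R]_d -> R) :
  mu.-integrable Omega (EFin \o f) -> mu.-integrable Omega (EFin \o g) ->
  \int[mu]_(x in Omega) (a * f x + g x) =
  a * \int[mu]_(x in Omega) f x + \int[mu]_(x in Omega) g x.
Proof.
move=> jf ig; rewrite -RintegralZl// -RintegralD//.
exact: (integrableZl mOmega a jf).
Qed.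

Lemma Rintegral_sum (I : Type) (s : seq I) (f : I -> 'rV[R]_d -> R) :
  (forall i, mu.-integrable Omega (EFin \o f i)) ->
  \int[mu]_(x in Omega) (\sum_(i <- s) f i x) =
  \sum_(i <- s) \int[mu]_(x in Omega) f i x.
Proof.
move=> jf; elim: s => [|i s ih].
  rewrite big_nil; under eq_Rintegral do rewrite big_nil.
  by rewrite Rintegral_cst// mul0r.
rewrite big_cons -ih -RintegralD//; last exact: integrable_sumR.
by apply: eq_Rintegral => x _; rewrite big_cons.
Qed.

Definition test_field (phi : vfield R d) :=
  forall i, test_fun Omega (fun x => phi x ord0 i).

(** The classical gradient of a test field, in the role of the weak gradient. *)
Definition test_pair (phi : vfield R d) : h1field R d := (phi, gradient phi).

Lemma L2_test_field phi : test_field phi -> L2 Omega phi.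
Proof. by move=> tp i j; rewrite ord1; exact: test_fun_square_integrable. Qed.

Lemma L2_gradient phi : test_field phi -> L2 Omega (gradient phi).
Proof.
move=> tp i j; rewrite (_ : (fun x => _) = pderive j (fun y => phi y ord0 i)).
  exact/test_fun_square_integrable/test_fun_pderive.
by apply/funext => x; rewrite mxE.
Qed.

(** Only the weak gradient needs an argument, the integration by parts of smooth
    functions; the approximating sequence is constant. *)
Lemma test_field_X phi : test_field phi -> X Omega (test_pair phi).
Proof.
move=> tp; split.
  split; [exact: L2_test_field|exact: L2_gradient|].
  move=> i j psi tpsi; have [sphi _] := tp i.
  rewrite (test_fun_by_parts mOmega j sphi)//; congr (- _).
  by apply: eq_Rintegral => x _; rewrite mxE.
exists (fun=> phi); split => //=; rewrite subrr L2norm0//; exact: cvg_cst.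
Qed.

Lemma test_fieldZD a phi psi :
  test_field phi -> test_field psi -> test_field (a *: phi + psi).
Proof.
move=> tp ts i.
rewrite (_ : (fun x => _) = fun x => a * phi x ord0 i + psi x ord0 i).
  exact: test_funZD.
by apply/funext => x; rewrite !mxE.
Qed.

Lemma gradientZD a phi psi : test_field phi -> test_field psi ->
  gradient (a *: phi + psi) = a *: gradient phi + gradient psi.
Proof.
move=> tp ts; apply/funext => x; apply/matrixP => i j; rewrite !mxE.
have [sp _] := tp i; have [ss _] := ts i.
have e : (fun y => (a *: phi + psi) y ord0 i) =
    (fun y => a * phi y ord0 i + psi y ord0 i).
  by apply/funext => y; rewrite !mxE.
by rewrite e (pderiveZD a j sp ss).
Qed.

Lemma square_integrable_test (f psi : 'rV[R]_d -> R) :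
  square_integrable Omega f -> test_fun Omega psi ->
  mu.-integrable Omega (EFin \o (fun x => f x * psi x)).
Proof.
move=> sf tpsi; apply: square_integrableM => //.
exact: test_fun_square_integrable.
Qed.

Lemma L2norm_ZD_cvg0 m n a (F G : 'rV[R]_d -> 'M[R]_(m, n))
    (Fn Gn : nat -> 'rV[R]_d -> 'M[R]_(m, n)) :
  L2 Omega F -> L2 Omega G -> (forall k, L2 Omega (Fn k)) ->
  (forall k, L2 Omega (Gn k)) ->
  L2norm Omega (F - Fn k) @[k --> \oo] --> (0 : R) ->
  L2norm Omega (G - Gn k) @[k --> \oo] --> (0 : R) ->
  L2norm Omega ((a *: F + G) - (a *: Fn k + Gn k)) @[k --> \oo] --> (0 : R).
Proof.
move=> lF lG lFn lGn cF cG.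
apply: (@squeeze_cvgr _ _ _ _ (fun=> 0)
  (fun k => `|a| * L2norm Omega (F - Fn k) + L2norm Omega (G - Gn k))).
- near=> k; rewrite L2norm_ge0 /=.
  rewrite opprD addrACA -scalerBr -L2normZ//; last exact: L2B.
  by apply: ler_L2normD => //; [apply: L2Z => //|]; exact: L2B.
- exact: cvg_cst.
- have := cvgD (cvgM (cvg_cst `|a|) cF) cG.
  by rewrite mulr0 addr0; apply.
Unshelve. all: by end_near. Qed.

Lemma X_ZD a (v w : h1field R d) : X Omega v -> X Omega w -> X Omega (a *: v + w).
Proof.
move=> [[lv lGv gv] [p [tp cp cgp]]] [[lw lGw gw] [q [tq cq cgq]]]; split.
  split; [exact: L2ZD|exact: L2ZD|].
  move=> i j psi tpsi; have tdpsi := test_fun_pderive j tpsi.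
  transitivity (a * \int[mu]_(x in Omega) (v.1 x ord0 i * pderive j psi x)
    + \int[mu]_(x in Omega) (w.1 x ord0 i * pderive j psi x)).
    rewrite -RintegralZD; try exact: square_integrable_test.
    by apply: eq_Rintegral => x _; rewrite !mxE mulrDl mulrA.
  rewrite gv// gw// mulrN -opprD -RintegralZD; try exact: square_integrable_test.
  by congr (- _); apply: eq_Rintegral => x _; rewrite !mxE mulrDl mulrA.
exists (fun k => a *: p k + q k); split.
- by move=> k i; exact: test_fieldZD.
- exact: (L2norm_ZD_cvg0 a lv lw (fun k => L2_test_field (tp k))
            (fun k => L2_test_field (tq k)) cp cq).
- have e : (fun k => L2norm Omega (a *: v.2 + w.2 - gradient (a *: p k + q k))) =
    (fun k => L2norm Omega (a *: v.2 + w.2 - (a *: gradient (p k) + gradient (q k)))).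
    by apply/funext => k; rewrite gradientZD.
  rewrite [X in X @ _]e.
  exact: (L2norm_ZD_cvg0 a lGv lGw (fun k => L2_gradient (tp k))
            (fun k => L2_gradient (tq k)) cgp cgq).
Qed.

Lemma X_B (v w : h1field R d) : X Omega v -> X Omega w -> X Omega (v - w).
Proof. by move=> Xv Xw; rewrite addrC -scaleN1r; exact: X_ZD. Qed.

Lemma X_L2_grad (v : h1field R d) : X Omega v -> L2 Omega v.2.
Proof. by case=> [[]]. Qed.

(** Testing the divergence against q is testing the gradient against the
    scalar matrix field q I, so that the Hilbert space estimates apply. *)
Lemma mxdot_scalar (A : 'M[R]_d) (q : R) : mxdot A q%:M = \tr A * q.
Proof.
rewrite /mxdot /mxtrace mulr_suml; apply: eq_bigr => i _.
rewrite (bigD1 i)//= mxE eqxx mulr1n big1 ?addr0// => j ji.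
by rewrite mxE eq_sym (negbTE ji) mulr0n mulr0.
Qed.

Lemma L2_scalar (q : 'rV[R]_d -> R) :
  square_integrable Omega q -> L2 Omega (fun x => (q x)%:M : 'M[R]_d).
Proof.
move=> sq i j; have [<-|ij] := eqVneq i j.
  by rewrite (_ : (fun x => _) = q)//; apply/funext => x; rewrite mxE eqxx mulr1n.
rewrite (_ : (fun x => _) = fun=> 0); first exact: square_integrable0.
by apply/funext => x; rewrite mxE (negbTE ij).
Qed.

Lemma divergence_L2dot (v : h1field R d) (q : 'rV[R]_d -> R) :
  \int[mu]_(x in Omega) (divergence v x * q x) =
  L2dot Omega v.2 (fun x => (q x)%:M).
Proof. by apply: eq_Rintegral => x _; rewrite mxdot_scalar. Qed.

Lemma V_ZD a (v w : h1field R d) : V Omega v -> V Omega w -> V Omega (a *: v + w).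
Proof.
move=> [Xv dv] [Xw dw]; split; first exact: X_ZD.
move=> q Qq; have [sq _ _] := Qq; have lq := L2_scalar sq.
have lv := X_L2_grad Xv; have lw := X_L2_grad Xw.
rewrite divergence_L2dot /= L2dotDl ?L2dotZl//; last exact: L2Z.
by rewrite -!divergence_L2dot dv// dw// mulr0 addr0.
Qed.

Lemma V_B (v w : h1field R d) : V Omega v -> V Omega w -> V Omega (v - w).
Proof. by move=> Vv Vw; rewrite addrC -scaleN1r; exact: V_ZD. Qed.

Lemma V_D (v w : h1field R d) : V Omega v -> V Omega w -> V Omega (v + w).
Proof. by move=> Vv Vw; rewrite -[v]scale1r; exact: V_ZD. Qed.

Lemma V_X (v : h1field R d) : V Omega v -> X Omega v.
Proof. by case. Qed.

End spaces_theory.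

(** * Divergence-free fields are orthogonal to all test functions *)

Section divergence_free.
Context (R : realType) (d : nat) (Omega : set 'rV[R]_d).
Hypothesis mOmega : measurable Omega.
Let mu := lebesgue_rV R d.
Local Notation ind A := (\1_A : 'rV[R]_d -> R).

Lemma square_integrable_indic (A : set 'rV[R]_d) :
  measurable A -> A `<=` Omega -> (mu A < +oo)%E ->
  square_integrable Omega (ind A) /\ mu.-integrable Omega (EFin \o ind A).
Proof.
move=> mA AO Aoo.
have iA : mu.-integrable Omega (EFin \o ind A).
  apply/integrableP; split; first by apply/measurable_EFinP; exact: measurable_indic.
  rewrite (eq_integral (fun x => (ind A x)%:E)); last first.
    by move=> x _ /=; rewrite ger0_norm.
  by rewrite integral_indic// setIidl.
split=> //; split; first exact: measurable_indic.
rewrite (_ : (fun x => _) = EFin \o ind A)//; apply/funext => x /=.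
by rewrite indicE expr2 -natrM mulnb andbb.
Qed.

Lemma Rintegral_ind (A : set 'rV[R]_d) : measurable A -> A `<=` Omega ->
  \int[mu]_(x in Omega) ind A x = fine (mu A).
Proof. by move=> mA AO; rewrite /Rintegral integral_indic// setIidl. Qed.

(** The combination |A| psi - (int psi) 1_A has mean value zero, hence is
    admissible as a test for the divergence constraint. *)
Lemma divergence_test_balance (u : h1field R d) (psi : 'rV[R]_d -> R)
    (A : set 'rV[R]_d) : V Omega u -> test_fun Omega psi ->
  measurable A -> A `<=` Omega -> (mu A < +oo)%E ->
  fine (mu A) * \int[mu]_(x in Omega) (divergence u x * psi x) =
  (\int[mu]_(x in Omega) psi x) *
    \int[mu]_(x in Omega) (divergence u x * ind A x).
Proof.
move=> [Xu du] tpsi mA AO Aoo.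
have [sA iA] := square_integrable_indic mA AO Aoo.
have spsi := test_fun_square_integrable mOmega tpsi.
have ipsi := test_fun_integrable mOmega tpsi.
set m := fine (mu A); set c := \int[mu]_(x in Omega) psi x.
pose q x := m * psi x + (- c * ind A x + 0).
have s0 : square_integrable Omega (fun _ : 'rV[R]_d => 0 : R) := square_integrable0 _.
have sq : square_integrable Omega q.
  by apply: square_integrableZD => //; apply: square_integrableZD.
have icA : mu.-integrable Omega (EFin \o (fun x => - c * ind A x + 0)).
  under eq_fun do rewrite addr0.
  exact: (integrableZl mOmega (- c) iA).
have iq : mu.-integrable Omega (EFin \o q).
  have h := integrableD mOmega (integrableZl mOmega m ipsi) icA.
  by apply: eq_integrable h.
have Qq : Q Omega q.
  split => //; rewrite RintegralZD// -/c.
  under [X in _ + X]eq_Rintegral do rewrite addr0.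
  by rewrite RintegralZl// Rintegral_ind// -/m mulNr mulrC subrr.
have lu := X_L2_grad Xu.
have := du q Qq; rewrite !divergence_L2dot.
have -> : (fun x => (q x)%:M : 'M[R]_d) =
    m *: (fun x => (psi x)%:M) - c *: (fun x => (ind A x)%:M).
  apply/funext => x; rewrite /q addr0 raddfD /= -!scale_scalar_mx.
  by rewrite scaleNr.
have lp := L2_scalar spsi; have lA := L2_scalar sA.
rewrite L2dotBr//; try exact: L2Z.
rewrite (L2dotC _ _ (m *: _)) (L2dotC _ _ (c *: _)) !L2dotZl//.
by rewrite !(L2dotC _ u.2) => /eqP; rewrite subr_eq0 => /eqP.
Qed.

(** The divergence theorem for fields vanishing on the boundary: it is trivial for
    test fields, and 1_Omega I is square integrable when |Omega| is finite, so it
    passes to the limit. *)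
Lemma divergence_mean0 (u : h1field R d) : X Omega u -> (mu Omega < +oo)%E ->
  \int[mu]_(x in Omega) (divergence u x * ind Omega x) = 0.
Proof.
move=> Xu Ooo; have [[lu lGu gu] [p [tp cp cgp]]] := Xu.
have [sO _] := square_integrable_indic mOmega (@subset_refl _ Omega) Ooo.
have lI := L2_scalar sO.
rewrite divergence_L2dot; set I := fun x => _.
have test0 k : L2dot Omega (gradient (p k)) I = 0.
  rewrite -(divergence_L2dot _ (test_pair (p k))).
  transitivity (\int[mu]_(x in Omega) \sum_(i < d) pderive i (fun y => p k y ord0 i) x).
    apply: eq_Rintegral => x xO; rewrite indicE xO mulr1.
    by apply: eq_bigr => i _; rewrite mxE.
  rewrite Rintegral_sum//; last first.
    by move=> i; exact/(test_fun_integrable mOmega)/test_fun_pderive.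
  by rewrite big1// => i _; exact: test_fun_int_pderive0.
apply/eqP; rewrite -normr_le0.
have cC : L2norm Omega (u.2 - gradient (p k)) * L2norm Omega I @[k --> \oo] --> (0 : R).
  have := cvgM cgp (cvg_cst (L2norm Omega I)).
  by rewrite mul0r; apply.
apply: (cvgr_to_ge cC); near=> k.
have lp := L2_gradient mOmega (tp k).
rewrite -[X in `|X|]subr0 -(test0 k) -L2dotBl//.
by apply: ler_abs_L2dot => //; exact: L2B.
Unshelve. all: by end_near. Qed.

Lemma L2norm_indic (A : set 'rV[R]_d) : measurable A -> A `<=` Omega -> (mu A < +oo)%E ->
  L2norm Omega (fun x => (ind A x)%:M : 'M[R]_d) ^+ 2 = d%:R * fine (mu A).
Proof.
move=> mA AO Aoo; have [_ iA] := square_integrable_indic mA AO Aoo.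
rewrite sqr_L2norm /L2dot.
transitivity (\int[mu]_(x in Omega) (d%:R * ind A x)).
  apply: eq_Rintegral => x _; rewrite mxdot_scalar mxtrace_scalar.
  by rewrite indicE; case: (x \in A); rewrite ?mulr1 ?mulr0 ?mulr0n.
by rewrite RintegralZl// Rintegral_ind.
Qed.

(** The divergence constraint only tests against functions of mean zero. If
    |Omega| is finite, subtracting the mean of psi costs nothing since div u has
    mean zero itself. On a domain of infinite measure the constant is spread over
    the truncations A of Omega by cubes: the price (int psi) int_A div u grows
    only like the square root of |A| by Cauchy-Schwarz, whereas the left-hand side
    of the balance grows like |A|. *)
Lemma divergence_test_orthogonal (u : h1field R d) (psi : 'rV[R]_d -> R) :
  V Omega u -> test_fun Omega psi ->
  \int[mu]_(x in Omega) (divergence u x * psi x) = 0.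
Proof.
move=> Vu tpsi; have Xu := V_X Vu; have lu := X_L2_grad Xu.
set I := \int[mu]_(x in Omega) _.
have [Ooo|Ooo] := boolP (mu Omega < +oo)%E.
  have := divergence_test_balance Vu tpsi mOmega (@subset_refl _ _) Ooo.
  rewrite divergence_mean0// mulr0 => /eqP; rewrite mulf_eq0 => /orP[|/eqP//].
  rewrite fine_eq0 ?ge0_fin_numE// => /eqP O0.
  rewrite /I /Rintegral null_set_integral//=.
  have spsi := test_fun_square_integrable mOmega tpsi.
  have ii := integrable_mxdot mOmega lu (L2_scalar spsi).
  by have /integrableP[] := ii; under eq_fun do rewrite /= mxdot_scalar.
(* If I were nonzero, the measures of the truncations would stay below
   B / |I|^2, hence so would the measure of Omega. *)
pose A n := Omega `&` cube n%:R.
have mA n : measurable (A n) by apply: measurableI => //; exact: measurable_cube.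
have AO n : A n `<=` Omega by move=> x [].
have Aoo n : (mu (A n) < +oo)%E.
  apply: le_lt_trans (lebesgue_cube_lty d n%:R).
  by apply: le_measure; rewrite ?inE//; [exact: measurable_cube|move=> x []].
pose m n := fine (mu (A n)).
have m0 n : 0 <= m n by rewrite fine_ge0// measure_ge0.
have bound n : m n * `|I| ^+ 2 <=
    (\int[mu]_(x in Omega) psi x) ^+ 2 * L2norm Omega u.2 ^+ 2 * d%:R.
  have [sA _] := square_integrable_indic (mA n) (AO n) (Aoo n).
  have := divergence_test_balance Vu tpsi (mA n) (AO n) (Aoo n).
  rewrite -/I -/(m n) divergence_L2dot; set c := Rintegral _ _ _.
  have := ler_abs_L2dot mOmega lu (L2_scalar sA).
  have := L2norm_indic (mA n) (AO n) (Aoo n); rewrite -/(m n).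
  set N := L2norm _ (fun x => _); set D := L2dot _ _ _; set G := L2norm _ u.2.
  move=> N2 DGN mI.
  have D2 : D ^+ 2 <= G ^+ 2 * (d%:R * m n).
    rewrite -N2 -exprMn -[D ^+ 2]real_normK ?num_real//.
    by rewrite ler_pXn2r// ?nnegrE// mulr_ge0// L2norm_ge0.
  have [mn0|mn0] := eqVneq (m n) 0.
    by rewrite mn0 mul0r; apply: mulr_ge0 => //; apply: mulr_ge0; exact: sqr_ge0.
  have mn_gt0 : 0 < m n by rewrite lt_neqAle eq_sym mn0 m0.
  rewrite -(ler_pM2l mn_gt0) real_normK ?num_real//.
  rewrite (_ : m n * (m n * I ^+ 2) = (m n * I) ^+ 2); last by ring.
  rewrite mI exprMn.
  rewrite (_ : m n * _ = c ^+ 2 * (G ^+ 2 * (d%:R * m n))); last by ring.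
  by rewrite ler_wpM2l// sqr_ge0.
apply/eqP; rewrite -normr_eq0; apply/negPn/negP => I0.
have I2 : 0 < `|I| ^+ 2 by rewrite exprn_gt0// lt_neqAle eq_sym I0 normr_ge0.
case/negP: Ooo.
set B := _ * d%:R in bound.
apply: (@le_lt_trans _ _ (B / `|I| ^+ 2)%:E); last exact: ltry.
have UA : Omega = \bigcup_n A n.
  apply/seteqP; split => [x Ox|x [n _] []//].
  have [r r0 xr] := compact_sub_cube (@compact_set1 _ x).
  exists (Num.truncn r).+1 => //; split=> // j.
  by rewrite (le_trans (xr x erefl j))// ltW// truncnS_gt.
have cA : mu (A n) @[n --> \oo] --> mu Omega.
  rewrite [X in _ --> mu X]UA; apply: nondecreasing_cvg_mu => //.
    by rewrite -UA.
  move=> n k nk; apply/subsetPset => x [Ox xn]; split=> // j.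
  by rewrite (le_trans (xn j))// ler_nat.
apply: (cvge_to_le cA); apply: nearW => n.
rewrite -[leLHS]fineK ?ge0_fin_numE// lee_fin -/(m n).
by rewrite ler_pdivlMr.
Qed.

End divergence_free.

(** * The trilinear form *)

Section trilinear.
Context (R : realType) (d : nat) (Omega : set 'rV[R]_d) (M : R).
Hypothesis mOmega : measurable Omega.
Hypothesis hM : b_bound Omega M.
Let mu := lebesgue_rV R d.
Local Notation nrm v := (L2norm Omega v.2).
Local Notation h1 := (h1field R d).

Lemma b_integrable (u w v : h1) : X Omega u -> X Omega w -> X Omega v ->
  mu.-integrable Omega (EFin \o (fun x => mxdot (convection u w x) (v.1 x))).
Proof. by move=> Xu Xw Xv; have [] := hM Xu Xw Xv. Qed.

Lemma b_ZDl a (u u' w v : h1) :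
  X Omega u -> X Omega u' -> X Omega w -> X Omega v ->
  b Omega (a *: u + u') w v = a * b Omega u w v + b Omega u' w v.
Proof.
move=> Xu Xu' Xw Xv; rewrite /b /L2dot -RintegralZD//; try exact: b_integrable.
apply: eq_Rintegral => x _; rewrite -mxdotZl -mxdotDl; congr mxdot.
by rewrite /convection scalemxAl -mulmxDl.
Qed.

Lemma b_ZDm a (u w w' v : h1) :
  X Omega u -> X Omega w -> X Omega w' -> X Omega v ->
  b Omega u (a *: w + w') v = a * b Omega u w v + b Omega u w' v.
Proof.
move=> Xu Xw Xw' Xv; rewrite /b /L2dot -RintegralZD//; try exact: b_integrable.
apply: eq_Rintegral => x _; rewrite -mxdotZl -mxdotDl; congr mxdot.
by rewrite /convection scalemxAr -mulmxDr; congr (_ *m _); rewrite linearP.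
Qed.

Lemma b_ZDr a (u w v v' : h1) :
  X Omega u -> X Omega w -> X Omega v -> X Omega v' ->
  b Omega u w (a *: v + v') = a * b Omega u w v + b Omega u w v'.
Proof.
move=> Xu Xw Xv Xv'; rewrite /b /L2dot -RintegralZD//; try exact: b_integrable.
by apply: eq_Rintegral => x _; rewrite 3!(mxdotC (convection _ _ _)) -mxdotZl -mxdotDl.
Qed.

Lemma b_Bl (u u' w v : h1) :
  X Omega u -> X Omega u' -> X Omega w -> X Omega v ->
  b Omega (u - u') w v = b Omega u w v - b Omega u' w v.
Proof.
by move=> Xu Xu' Xw Xv; rewrite addrC -scaleN1r b_ZDl// mulN1r addrC.
Qed.

Lemma b_Bm (u w w' v : h1) :
  X Omega u -> X Omega w -> X Omega w' -> X Omega v ->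
  b Omega u (w - w') v = b Omega u w v - b Omega u w' v.
Proof.
by move=> Xu Xw Xw' Xv; rewrite addrC -scaleN1r b_ZDm// mulN1r addrC.
Qed.

Lemma b_Br (u w v v' : h1) :
  X Omega u -> X Omega w -> X Omega v -> X Omega v' ->
  b Omega u w (v - v') = b Omega u w v - b Omega u w v'.
Proof.
by move=> Xu Xw Xv Xv'; rewrite addrC -scaleN1r b_ZDr// mulN1r addrC.
Qed.

(** The assumed upper bound at v and at -v. *)
Lemma b_le (u w v : h1) : X Omega u -> X Omega w -> X Omega v ->
  `|b Omega u w v| <= M * nrm u * nrm w * nrm v.
Proof.
move=> Xu Xw Xv; have [_ _ h] := hM Xu Xw Xv.
rewrite ler_norml h andbT lerNl.
have Xv' := X_B mOmega Xv Xv.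
(* v - v - v stands for - v. *)
have XNv := X_B mOmega Xv' Xv.
have [_ _] := hM Xu Xw XNv.
rewrite !b_Br// subrr sub0r => /le_trans; apply.
by rewrite /= subrr sub0r L2normN.
Qed.

(** For a test field the integrand is (u . grad) applied to |phi|^2 / 2, so that
    integrating by parts leaves the divergence of u tested against |phi|^2 / 2. *)
Lemma b_test0 (u : h1) (phi : vfield R d) : V Omega u -> test_field Omega phi ->
  b Omega u (test_pair phi) (test_pair phi) = 0.
Proof.
move=> Vu tp; have Xu := V_X Vu; have [[lu lGu gu] _] := Xu.
pose c i x := phi x ord0 i.
pose psi x := \sum_i c i x * c i x.
have sc i : smooth (c i) by have [] := tp i.
have tpsi : test_fun Omega psi.
  by apply: test_fun_sum => i; apply: test_funMr => //; exact: tp.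
have dpsi j : pderive j psi = fun x => \sum_i 2 * (c i x * pderive j (c i) x).
  have sM i : smooth (fun x => c i x * c i x) by exact: smoothM.
  apply/funext => x; rewrite /psi.
  elim: (index_enum _) => [|i s ih].
    rewrite big_nil (_ : (fun x => _) = cst 0) ?/pderive ?derive_cst//.
    by apply/funext => y; rewrite big_nil.
  have ss : smooth (fun x => \sum_(i <- s) c i x * c i x).
    by have [] : test_fun Omega (fun x => \sum_(i <- s) c i x * c i x) by
      apply: test_fun_sum => k; apply: test_funMr => //; exact: tp.
  have e : (fun y => \sum_(i <- i :: s) c i y * c i y) =
      (fun y => 1 * (c i y * c i y) + \sum_(i <- s) c i y * c i y).
    by apply/funext => y; rewrite big_cons mul1r.
  rewrite e (pderiveZD 1 j (sM i) ss) big_cons ih pderiveM//; congr (_ + _).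
  by rewrite mul1r; ring.
have sq i : square_integrable Omega (fun x => u.1 x ord0 i) by exact: lu.
have iu j : mu.-integrable Omega (EFin \o (fun x => u.1 x ord0 j * pderive j psi x)).
  by apply: square_integrable_test => //; exact: test_fun_pderive.
have iG j : mu.-integrable Omega (EFin \o (fun x => u.2 x j j * psi x)).
  by apply: square_integrable_test => //; exact: lGu.
(* The factor 2 comes from differentiating psi = |phi|^2. *)
suff : 2 * b Omega u (test_pair phi) (test_pair phi) = 0.
  by move=> /eqP; rewrite mulf_eq0 pnatr_eq0 /= => /eqP.
have Xp := test_field_X mOmega tp.
rewrite /b /L2dot -RintegralZl//; last exact: b_integrable.
transitivity (\int[mu]_(x in Omega) (\sum_j u.1 x ord0 j * pderive j psi x)).
  apply: eq_Rintegral => x _.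
  transitivity (\sum_j \sum_i u.1 x ord0 j * (2 * (c i x * pderive j (c i) x))).
    rewrite exchange_big /= /mxdot big_ord1 mulr_sumr; apply: eq_bigr => i _.
    rewrite /convection mxE mulr_suml mulr_sumr; apply: eq_bigr => j _.
    by rewrite !mxE -/(c i x) /= -/(c i); ring.
  by apply: eq_bigr => j _; rewrite dpsi mulr_sumr.
rewrite Rintegral_sum//.
under eq_bigr do rewrite gu//.
rewrite sumrN -Rintegral_sum//; apply/eqP; rewrite oppr_eq0; apply/eqP.
rewrite (@eq_Rintegral _ _ _ _ _ (fun x => divergence u x * psi x)).
  exact: divergence_test_orthogonal.
by move=> x _; rewrite /divergence /mxtrace mulr_suml.
Qed.

(** Skew-symmetry extends from test fields to X by density, the trilinear form
    being continuous for the gradient norm. *)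
Lemma b_skew (u v : h1) : V Omega u -> X Omega v -> b Omega u v v = 0.
Proof.
move=> Vu Xv; have Xu := V_X Vu; have [_ [p [tp _ cp]]] := Xv.
apply/eqP; rewrite -normr_le0.
pose e k := L2norm Omega (v.2 - gradient (p k)).
pose K := `|M| * nrm u.
have cK : K * (e k * (2 * nrm v + e k)) @[k --> \oo] --> (0 : R).
  have c2 : 2 * nrm v + e k @[k --> \oo] --> 2 * nrm v + 0.
    exact: (cvgD (cvg_cst (2 * nrm v)) cp).
  have := cvgM (cvg_cst K) (cvgM cp c2).
  by rewrite mul0r mulr0; apply.
apply: (cvgr_to_ge cK); apply: nearW => k.
pose q := test_pair (p k); have Xq : X Omega q := test_field_X mOmega (tp k).
have Xvq := X_B mOmega Xv Xq.
have -> : b Omega u v v = b Omega u (v - q) v + b Omega u q (v - q).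
  by rewrite b_Bm// b_Br// (b_test0 Vu (tp k)) subr0 subrK.
have e0 : 0 <= e k by exact: L2norm_ge0.
have u0 : 0 <= nrm u by exact: L2norm_ge0.
have v0 : 0 <= nrm v by exact: L2norm_ge0.
have q0 : 0 <= nrm q by exact: L2norm_ge0.
have nq : nrm q <= nrm v + e k.
  rewrite /e L2normBC; apply: L2norm_le_near => //; exact: X_L2_grad.
have h1' := b_le Xu Xvq Xv.
have h2' := b_le Xu Xq Xvq.
rewrite (le_trans (ler_normD _ _))// (le_trans (lerD h1' h2'))//.
have -> : nrm (v - q) = e k by [].
apply: (@le_trans _ _ (K * (e k * (nrm v + nrm q)))).
  rewrite (_ : _ + _ = M * (nrm u * (e k * (nrm v + nrm q)))); last by ring.
  rewrite /K -mulrA ler_wpM2r ?ler_norm//.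
  by rewrite !mulr_ge0// addr_ge0.
rewrite ler_wpM2l ?mulr_ge0// ler_wpM2l//; lra.
Qed.

End trilinear.

(** * Energy estimates for the nudged Picard iteration *)

Section energy.
Context (R : realType) (d : nat) (Omega : set 'rV[R]_d) (M : R).
Hypothesis mOmega : measurable Omega.
Hypothesis hM : b_bound Omega M.
Context (nu : R) (f : vfield R d -> R).
Hypothesis hnu : 0 < nu.
Hypothesis hf : Hminus1 Omega f.
Local Notation nrm v := (L2norm Omega v.2).
Local Notation h1 := (h1field R d).
Local Notation F := (Hminus1_norm Omega f).

Lemma has_ubound_dual : has_ubound
  [set r | exists v, [/\ X Omega v, 0 < nrm v & r = `|f v.1| / nrm v]].
Proof.
have [_ [C hC]] := hf; exists C => r [v [Xv v0 ->]].
by rewrite ler_pdivrMr// hC.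
Qed.

Lemma dual_le (v : h1) : X Omega v -> `|f v.1| <= F * nrm v.
Proof.
move=> Xv; have [v0|v0] := eqVneq (nrm v) 0.
  by have [_ [C hC]] := hf; rewrite v0 mulr0; have := hC v Xv; rewrite v0 mulr0.
have vp : 0 < nrm v by rewrite lt_neqAle eq_sym v0 L2norm_ge0.
rewrite -ler_pdivrMr//; apply: ub_le_sup; first exact: has_ubound_dual.
by exists v.
Qed.

Lemma Hminus1_norm_ge0 (v : h1) : X Omega v -> 0 < nrm v -> 0 <= F.
Proof.
move=> Xv vp; have := dual_le Xv.
by move=> /(le_trans (normr_ge0 _)); rewrite pmulr_lge0.
Qed.

Lemma b_bound_ge0 (v : h1) : X Omega v -> 0 < nrm v -> 0 <= M.
Proof.
move=> Xv vp; have := b_le mOmega hM Xv Xv Xv.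
by move=> /(le_trans (normr_ge0 _)); rewrite !pmulr_lge0.
Qed.

(** Testing the equation with u itself. *)
Lemma steady_bound (u : h1) : steady_NSE Omega nu f u -> 0 <= F ->
  nrm u <= F / nu.
Proof.
move=> [Vu hu] F0; have Xu := V_X Vu.
have := hu u Vu; rewrite (b_skew mOmega hM Vu Xu) addr0 -sqr_L2norm => e.
have [u0|u0] := eqVneq (nrm u) 0; first by rewrite u0 divr_ge0// ltW.
have up : 0 < nrm u by rewrite lt_neqAle eq_sym u0 L2norm_ge0.
rewrite ler_pdivlMr// -(ler_pM2r up) mulrAC -expr2 mulrC e.
exact: le_trans (ler_norm _) (dual_le Xu).
Qed.

Context (CI H : R) (IH : vfield R d -> vfield R d).
Hypothesis hI : interpolation Omega CI H IH.

Lemma interpolation_L2 (v : h1) : X Omega v -> L2 Omega (IH v.1).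
Proof. by move=> /(hI.2 _)[]. Qed.

(** Linearity of the interpolation turns the nudging term, tested against the
    nudged quantity itself, into a square. *)
Lemma nudging_ge0 (v w : h1) : X Omega v -> X Omega w ->
  0 <= L2dot Omega (IH v.1 - IH w.1) (IH (v - w).1).
Proof.
move=> Xv Xw; have Xvw := X_B mOmega Xv Xw.
have lv := interpolation_L2 Xv; have lw := interpolation_L2 Xw.
have lvw := interpolation_L2 Xvw.
rewrite (_ : L2dot _ _ _ = L2dot Omega (IH (v - w).1) (IH (v - w).1)).
  exact: L2dot_ge0.
apply: (ae_eq_L2dot mOmega (L2B mOmega lv lw) lvw lvw).
have := hI.1 (-1) w v Xw Xv; apply: filterS => x h Ox.
have e : (v - w).1 = -1 *: w.1 + v.1 by rewrite scaleN1r addrC.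
by rewrite e (h Ox) scaleN1r addrC.
Qed.

Context (mu : R).
Hypothesis hmu : 0 <= mu.

(** Testing with uk1 - w cancels the convection of the error and makes the
    nudging term dissipative; polarization produces the three squares. *)
Lemma energy_estimate (w uk uk1 : h1) :
  V Omega w -> V Omega uk -> V Omega uk1 ->
  CDA_Picard_step Omega nu mu IH f w uk uk1 ->
  nu * (nrm uk1 ^+ 2 + nrm (uk1 - w) ^+ 2 - nrm w ^+ 2) <=
  2 * (F + M * nrm uk * nrm w) * nrm (uk1 - w).
Proof.
move=> Vw Vk Vk1 step; have Xw := V_X Vw; have Xk := V_X Vk; have Xk1 := V_X Vk1.
have Ve := V_B mOmega Vk1 Vw; have Xe := V_X Ve.
have lw := X_L2_grad Xw; have lk1 := X_L2_grad Xk1; have le := X_L2_grad Xe.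
have := step _ Ve.
have -> : b Omega uk uk1 (uk1 - w) = b Omega uk w (uk1 - w).
  by apply/eqP; rewrite -subr_eq0 -(b_Bm mOmega hM)// (b_skew mOmega hM).
have pol : nrm uk1 ^+ 2 + nrm (uk1 - w) ^+ 2 - nrm w ^+ 2
    = 2 * L2dot Omega uk1.2 (uk1 - w).2.
  rewrite !sqr_L2norm.
  have := L2dot_ZDZD mOmega 1 (-1) lk1 lw.
  rewrite scale1r scaleN1r => ->.
  by rewrite (L2dotBr mOmega lk1 lw lk1); ring.
rewrite pol.
have := nudging_ge0 Xk1 Xw; have := dual_le Xe; have := b_le mOmega hM Xk Xw Xe.
set B := b _ _ _ _; set N := L2dot _ (_ - _) _; set D := L2dot _ uk1.2 _.
set E := nrm (uk1 - w); rewrite !ler_norml => /andP[hB _] /andP[_ hF] hN eq.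
have muN : 0 <= mu * N by rewrite mulr_ge0.
nra.
Qed.

(** Consecutive equations are subtracted and tested with the new increment: the
    nudging term is again a square, and since b(u1, u2 - u1, u2 - u1) = 0, only
    the convection by the old increment remains. *)
Lemma increment_estimate (w u0 u1 u2 : h1) :
  V Omega w -> V Omega u0 -> V Omega u1 -> V Omega u2 ->
  CDA_Picard_step Omega nu mu IH f w u0 u1 ->
  CDA_Picard_step Omega nu mu IH f w u1 u2 ->
  0 <= M * nrm (u1 - u0) * nrm u1 ->
  nu * nrm (u2 - u1) <= M * nrm (u1 - u0) * nrm u1.
Proof.
move=> Vw V0 V1 V2 s1 s2 rhs0.
have Xw := V_X Vw; have X0 := V_X V0; have X1 := V_X V1; have X2 := V_X V2.
have Ve := V_B mOmega V2 V1; have Xe := V_X Ve.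
have Xd := X_B mOmega X1 X0.
have l1 := X_L2_grad X1; have l2 := X_L2_grad X2; have le := X_L2_grad Xe.
have := s2 _ Ve; rewrite -(s1 _ Ve) => /eqP; rewrite -subr_eq0 => /eqP.
have bE : b Omega u1 u2 (u2 - u1) - b Omega u0 u1 (u2 - u1)
   = b Omega (u1 - u0) u1 (u2 - u1).
  have := b_skew mOmega hM V1 Xe; rewrite (b_Bm mOmega hM)// => /eqP; rewrite subr_eq0 => /eqP ->.
  by rewrite (b_Bl mOmega hM).
have dE : L2dot Omega u2.2 (u2 - u1).2 - L2dot Omega u1.2 (u2 - u1).2
    = nrm (u2 - u1) ^+ 2.
  by rewrite sqr_L2norm -L2dotBl.
have nE : L2dot Omega (IH u2.1 - IH w.1) (IH (u2 - u1).1)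
   - L2dot Omega (IH u1.1 - IH w.1) (IH (u2 - u1).1)
   = L2dot Omega (IH u2.1 - IH u1.1) (IH (u2 - u1).1).
  have i1 := interpolation_L2 X1; have i2 := interpolation_L2 X2.
  have iw := interpolation_L2 Xw; have ie := interpolation_L2 Xe.
  by rewrite !L2dotBl//; ring.
have := nudging_ge0 X2 X1; rewrite -nE.
have := b_le mOmega hM Xd X1 Xe; rewrite -bE.
move: dE.
set D2 := L2dot Omega u2.2 _; set D1 := L2dot Omega u1.2 _.
set N2 := L2dot Omega (IH u2.1 - _) _; set N1 := L2dot Omega (IH u1.1 - _) _.
set B2 := b _ u1 _ _; set B1 := b _ u0 _ _.
rewrite ler_norml => dE /andP[hB _] hN eq.
have muN : 0 <= mu * (N2 - N1) by rewrite mulr_ge0.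
have [e0|e0] := eqVneq (nrm (u2 - u1)) 0; first by rewrite e0 mulr0.
have ep : 0 < nrm (u2 - u1) by rewrite lt_neqAle eq_sym e0 L2norm_ge0.
rewrite -(ler_pM2r ep).
have -> : nu * nrm (u2 - u1) * nrm (u2 - u1) = nu * (D2 - D1) by rewrite dE; ring.
by move: hB eq muN; lra.
Qed.

End energy.

(** The map y |-> A + 2 y / 9 contracts to its fixed point 9 A / 7. *)
Lemma eventually_le_of_affine_recursion (R : realType) (y : nat -> R) (A B : R) :
  (forall k, y k.+1 <= A + 2 / 9 * y k) -> 9 / 7 * A < B ->
  \forall k \near \oo, y k <= B.
Proof.
move=> hy AB.
have hk k : y k <= 9 / 7 * A + (2 / 9) ^+ k * (`|y 0%N| + `|9 / 7 * A|).
  elim: k => [|k ih].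
    rewrite expr0 mul1r addrCA ler_wpDr//; last exact: ler_norm.
    by have := ler_norm (- (9 / 7 * A)); rewrite normrN; lra.
  rewrite (le_trans (hy k))// exprS; lra.
have c : (2 / 9 : R) ^+ k * (`|y 0%N| + `|9 / 7 * A|) @[k --> \oo] --> (0 : R).
  rewrite -[X in _ --> X](mul0r (`|y 0%N| + `|9 / 7 * A|)).
  apply: cvgM; last exact: cvg_cst.
  by apply: cvg_expr; rewrite ger0_norm; lra.
have AB0 : 0 < B - 9 / 7 * A by rewrite subr_gt0.
near=> k.
have : (2 / 9 : R) ^+ k * (`|y 0%N| + `|9 / 7 * A|) < B - 9 / 7 * A.
  by near: k; exact: (cvgr_lt _ c).
have := hk k; lra.
Unshelve. all: by end_near. Qed.

(** * Convergence of the nudged Picard iteration *)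

Theorem theorem4p2 (R : realType) (d : nat) (hd : d = 2%N \/ d = 3%N)
    (Omega : set 'rV[R]_d) (hOmega : admissible_domain Omega)
    (M : R) (hM : b_bound Omega M)
    (nu : R) (hnu : 0 < nu)
    (f : vfield R d -> R) (hf : Hminus1 Omega f)
    (u : h1field R d) (hu : steady_NSE Omega nu f u)
    (hu_reg : bounded_gradient Omega u)
    (CI : R) (hCI : 0 < CI)
    (I_ : R -> vfield R d -> vfield R d)
    (hI : forall H : R, 0 < H -> interpolation Omega CI H (I_ H))
    (delta : R) (hdelta : 0 <= delta)
    (eps : h1field R d) (heps : V Omega eps)
    (hnoise : L2norm Omega (u + eps).2 <= (1 + delta) * L2norm Omega u.2) :
  let alpha := M * nu ^- 2 * Hminus1_norm Omega f in
  let alpha_delta := (1 + delta) * alpha in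
  let C_delta := 2 * Num.sqrt (1 + (1 + delta) ^+ 2) in
  alpha_delta < 3^-1 ->
  forall (H mu : R), 0 < H -> 0 <= mu ->
  forall uk : nat -> h1field R d,
    (forall k, V Omega (uk k)) ->
    (forall k, CDA_Picard_step Omega nu mu (I_ H) f (u + eps) (uk k) (uk k.+1)) ->
  \forall k \near \oo,
    L2norm Omega (uk k.+1 - uk k).2
      <= C_delta * alpha * L2norm Omega (uk k - uk k.-1).2.

Proof.
move=> alpha alpha_delta C_delta had H mu H0 mu0 uk Vk step.
have [oOmega _ _] := hOmega.
have mOmega := open_measurable_rV oOmega.
have Xk k := V_X (Vk k).
(* The signs of M and of the dual norm come from a field with nonzero gradient;
   without any, both sides of the conclusion vanish. *)
have [[v0 [Xv0 v0p]]|noX] := pselect (exists v, X Omega v /\ 0 < L2norm Omega v.2);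
  last first.
  have z v : X Omega v -> L2norm Omega v.2 = 0.
    move=> Xv; apply/eqP; rewrite eq_le L2norm_ge0 andbT leNgt.
    by apply/negP => v0; apply: noX; exists v.
  by apply: nearW => k; rewrite !z ?mulr0//; exact: X_B.
have F0 := Hminus1_norm_ge0 hf Xv0 v0p.
have M0 := b_bound_ge0 mOmega hM Xv0 v0p.
have Vu : V Omega u by case: hu.
have Vw := V_D mOmega Vu heps.
set F := Hminus1_norm Omega f in F0.
pose U := F / nu; pose s := 1 + delta.
pose Y k := L2norm Omega (uk k).2; pose W := L2norm Omega (u + eps).2.
have U0 : 0 <= U by rewrite divr_ge0// ltW.
have s0 : 0 <= s by rewrite addr_ge0.
have Y0 k : 0 <= Y k by exact: L2norm_ge0.
have W0 : 0 <= W by exact: L2norm_ge0.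
have WU : W <= s * U.
  by rewrite (le_trans hnoise)// ler_wpM2l//; exact: (steady_bound mOmega hM).
have nu0 : nu != 0 by rewrite gt_eqF.
have alphaE : alpha = M / nu * U by rewrite /alpha -/F /U; field.
have alpha0 : 0 <= alpha by rewrite alphaE mulr_ge0// divr_ge0// ltW.
have alpha_delta0 : 0 <= alpha_delta by rewrite mulr_ge0.
have MW : M * W <= nu * alpha_delta.
  have -> : nu * alpha_delta = M * (s * U).
    by rewrite /alpha_delta alphaE /s; field.
  by rewrite ler_wpM2l.
have recursion k : Y k.+1 ^+ 2 <= s ^+ 2 * U ^+ 2 + (U + alpha_delta * Y k) ^+ 2.
  have en := energy_estimate mOmega hM hf (hI _ H0) mu0 Vw (Vk k) (Vk k.+1) (step k).
  set E := L2norm Omega (uk k.+1 - (u + eps)).2 in en.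
  have E0 : 0 <= E by exact: L2norm_ge0.
  rewrite -/F -/(Y k) -/(Y k.+1) -/W in en.
  have FU : F = nu * U by rewrite /U; field.
  have YE0 : 0 <= Y k * E by rewrite mulr_ge0.
  have h : M * Y k * W * E <= nu * alpha_delta * (Y k * E).
    by rewrite (_ : _ * E = M * W * (Y k * E)); [rewrite ler_wpM2r|ring].
  have {}en : Y k.+1 ^+ 2 + E ^+ 2 - W ^+ 2 <= 2 * (U + alpha_delta * Y k) * E.
    by rewrite -(ler_pM2l hnu) (le_trans en)// FU; lra.
  have W2 : W ^+ 2 <= s ^+ 2 * U ^+ 2.
    by rewrite -exprMn ler_pXn2r ?nnegrE// mulr_ge0.
  by have := sqr_ge0 (U + alpha_delta * Y k - E); lra.
have Ybnd : \forall k \near \oo, Y k <= C_delta * U.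
  have sq0 : 0 <= 1 + s ^+ 2 by rewrite addr_ge0// sqr_ge0.
  have C0 : 0 <= C_delta by rewrite mulr_ge0// sqrtr_ge0.
  have CU2 : (C_delta * U) ^+ 2 = 4 * (1 + s ^+ 2) * U ^+ 2.
    by rewrite /C_delta !exprMn sqr_sqrtr// -/s; ring.
  (* Without forcing, the bound below is not strict; but then alpha = 0
     and the recursion kills the iterate in one step. *)
  have [U00|Un0] := eqVneq U 0.
    have ad0 : alpha_delta = 0 by rewrite /alpha_delta alphaE U00 !mulr0.
    exists 1%N => // -[//|k] _.
    have := recursion k; rewrite U00 ad0 mulr0 mul0r addr0 expr0n /= mulr0 addr0.
    by move=> h; rewrite -(@ler_pXn2r _ 2) ?nnegrE// expr0n.
  have Up : 0 < U by rewrite lt_neqAle eq_sym Un0.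
  have U2 : 0 < U ^+ 2 by rewrite exprn_gt0.
  have h : \forall k \near \oo, Y k ^+ 2 <= (C_delta * U) ^+ 2.
    apply: (@eventually_le_of_affine_recursion _ _ ((s ^+ 2 + 2) * U ^+ 2)).
      move=> k; rewrite (le_trans (recursion k))//.
      (* (U + a)^2 <= 2 U^2 + 2 a^2 with a <= Y/3, whence the ratio 2/9. *)
      have aY : alpha_delta * Y k <= 3^-1 * Y k by rewrite ler_wpM2r// ltW.
      have aY0 : 0 <= alpha_delta * Y k by rewrite mulr_ge0.
      have aY2 : (alpha_delta * Y k) ^+ 2 <= 1 / 9 * Y k ^+ 2.
        rewrite (_ : 1 / 9 * Y k ^+ 2 = (3^-1 * Y k) ^+ 2); last by field.
        by rewrite ler_pXn2r ?nnegrE// mulr_ge0.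
      have := sqr_ge0 (U - alpha_delta * Y k); move: aY2.
      by set a := alpha_delta * Y k; lra.
    (* The fixed point (9/7) (s^2 + 2) U^2 is strictly below the target. *)
    rewrite CU2 mulrA ltr_pM2r//.
    by have := sqr_ge0 s; lra.
  by apply: filterS h => k; rewrite ler_pXn2r ?nnegrE ?(mulr_ge0 C0 U0).
have := Ybnd; apply: filterS2 (nbhs_infty_gt 0) => -[//|k] _ YC.
have M1 : 0 <= M * L2norm Omega (uk k.+1 - uk k).2 by rewrite mulr_ge0// L2norm_ge0.
have inc := increment_estimate mOmega hM (hI _ H0) mu0 Vw (Vk k) (Vk k.+1)
  (Vk k.+2) (step k) (step k.+1) (mulr_ge0 M1 (Y0 k.+1)).
rewrite /= -(ler_pM2l hnu) (le_trans inc)//.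
rewrite -/(Y k.+1) (le_trans (ler_wpM2l M1 YC))//.
by rewrite alphaE le_eqVlt; apply/orP; left; apply/eqP; field.
Qed.
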